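(* (Global convergence of GEORCE for Finsler manifolds.) Let $E_F^{(i)}=E_F\big(x^{(i)},u^{(i)}\big)$ be the value of the discretized Finsler energy functional at the solution $\big(x^{(i)},u^{(i)}\big)$ after iteration $i$ (with line search) of the GEORCE algorithm for Finsler manifolds. If the starting point $\big(x^{(0)},u^{(0)}\big)$ is feasible, then the sequence $\{E_F^{(i)}\}_{i>0}$ converges to a (local) minimum of the discretized Finsler energy functional over the feasible set (i.e. it converges, and its limit is the value of $E_F$ at a (local) minimum point).
   Context: Setting. $U\subseteq\mathbb{R}^d$ is open (the domain of a chart of a differentiable manifold) and $F$ is a Finsler metric in local coordinates: $F(x,v)\ge 0$ for $x\in U$, $v\in\mathbb{R}^d$, $F$ is $C^\infty$ away from $v=0$, $F(x,cv)=cF(x,v)$ for $c>0$, and the fundamental tensor $G(x,v)=\Big(\tfrac12\frac{\partial^2F^2}{\partial v^i\partial v^j}(x,v)\Big)_{ij}$ is positive definite for $v\neq0$. Let $a,b\in U$ and let $T$ be the number of subintervals. For $x=(x_0,\dots,x_T)$, $u=(u_0,\dots,u_{T-1})$, put $E_F(x,u)=\sum_{t=0}^{T-1}u_t^\top G(x_t,u_t)u_t$. A pair $(x,u)$ is feasible if $x_{t+1}=x_t+u_t$ for $t=0,\dots,T-1$, $x_0=a$, $x_T=b$. ''(Local) minimum'' refers to minimizing $E_F$ over feasible pairs. GEORCE algorithm for Finsler manifolds. Given a feasible $(x^{(i)},u^{(i)})$, put $G_t=G(x_t^{(i)},u_t^{(i)})$ for $t=0,\dots,T-1$, $\nu_t=\nabla_y\big(u_t^{(i)\top}G(y,u_t^{(i)})u_t^{(i)}\big)\big|_{y=x_t^{(i)}}$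 for $t=1,\dots,T-1$, and $\zeta_t=\nabla_y\big(u_t^{(i)\top}G(x_t^{(i)},y)u_t^{(i)}\big)\big|_{y=u_t^{(i)}}$ for $t=0,\dots,T-1$. Compute $$\mu_{T-1}=\Big(\sum_{t=0}^{T-1}G_t^{-1}\Big)^{-1}\Big(2(a-b)-\sum_{t=0}^{T-1}G_t^{-1}\Big(\zeta_t+\sum_{j=t+1}^{T-1}\nu_j\Big)\Big),\qquad \tilde u_t=-\tfrac12G_t^{-1}\Big(\mu_{T-1}+\zeta_t+\sum_{j=t+1}^{T-1}\nu_j\Big).$$ For a step size $\alpha$, let $\tilde x_0=a$, $\tilde x_{t+1}=\tilde x_t+\alpha\tilde u_t+(1-\alpha)u_t^{(i)}$. The line search picks $\alpha^*$ minimizing the discretized Finsler energy of the curve $\tilde x_{0:T}$ over $\alpha$ (exact line search). Then $u_t^{(i+1)}=\alpha^*\tilde u_t+(1-\alpha^* )u_t^{(i)}$, $x_0^{(i+1)}=a$, $x_{t+1}^{(i+1)}=x_t^{(i+1)}+u_t^{(i+1)}$. Standing assumptions. All quantities appearing in the computations are well-defined within the chart (the starting curve has all its points in $U$, and the line search only considers points in $U$). The end points are not conjugate, and the discretization is sufficiently fine that every critical point of the discretized energy functional (over feasible pairs) is a local or global minimum point.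
   Formalization: Adds the assumption that for each t the points x_t^(i) of the iterates accumulate only inside U (automatic when U is all of R^d); without it the iterates can converge to a point missing from U and no minimum point need exist. *)

(* Defs.v *)
From HB Require Import structures.
From mathcomp Require Import all_boot all_order all_algebra.
From mathcomp Require Import all_classical all_reals.
From mathcomp Require Import topology normedtype derive.
Set Implicit Arguments.
Unset Strict Implicit.
Unset Printing Implicit Defensive.
Import Order.TTheory GRing.Theory Num.Theory.
Import numFieldNormedType.Exports.
Local Open Scope classical_set_scope.
Local Open Scope ring_scope.

(* [f] is C^oo on the open set [D]: the iterated directional derivatives of [f]
   of every order exist and are continuous at every point of [D]. *)
Definition smooth_on (R : realType) (V W : normedModType R)
    (D : set V) (f : V -> W) : Prop :=
  forall (vs : seq V) (p : V), D p ->
    let g := foldr (fun v h => 'D_v h) f vs in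
    {for p, continuous g} /\ forall v, derivable g p v.

Definition grad (R : realType) (d : nat) (f : 'cV[R]_d -> R) (y : 'cV[R]_d) :
    'cV[R]_d :=
  \col_i 'D_(delta_mx i 0) f y.

Section Finsler.
Context (R : realType) (d : nat).
Implicit Types (U : set 'cV[R]_d) (F : 'cV[R]_d -> 'cV[R]_d -> R).

Definition fundamental_tensor F (x v : 'cV[R]_d) : 'M[R]_d :=
  \matrix_(i, j) (2^-1 *
    'D_(delta_mx i 0) ('D_(delta_mx j 0) (fun w => F x w ^+ 2)) v).

(* [y^T G(x, v) y] *)
Definition quad F (x v y : 'cV[R]_d) : R :=
  (y^T *m fundamental_tensor F x v *m y) 0 0.

(* [F] is total; nothing is required of [F x] for [x] outside of [U]. *)
Definition finsler_metric U F : Prop :=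
  [/\ forall x v, U x -> 0 <= F x v,
      smooth_on [set p : 'cV[R]_d * 'cV[R]_d | U p.1 /\ p.2 != 0]
        (fun p => F p.1 p.2),
      forall x v c, U x -> 0 < c -> F x (c *: v) = c * F x v
    & forall x v y, U x -> v != 0 -> y != 0 -> 0 < quad F x v y].

(* Regular solutions of the Euler-Lagrange equation of [F^2], i.e. geodesics
   with constant-speed parametrization, on a neighbourhood of [0, 1]. *)
Definition geodesic U F (g : R -> 'cV[R]_d) : Prop :=
  exists2 e : R, 0 < e & forall t : R, t \in `]- e, 1 + e[ ->
    [/\ U (g t), derivable g t 1, 'D_1 g t != 0
      & is_derive t 1 (fun s => grad (fun w => F (g s) w ^+ 2) ('D_1 g s))
          (grad (fun y => F y ('D_1 g t) ^+ 2) (g t))].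

(* Jacobi fields along [g] are the variation fields of smooth variations of [g]
   through geodesics; the pair [(s, t)] is (variation parameter, time). *)
Definition jacobi_field U F (g J : R -> 'cV[R]_d) : Prop :=
  exists (H : R * R -> 'cV[R]_d) (e : R),
    [/\ 0 < e,
        smooth_on [set p : R * R | (p.1 \in `]- e, e[) && (p.2 \in `]- e, 1 + e[)] H,
        forall t : R, t \in `[0, 1] -> H (0, t) = g t,
        forall s : R, s \in `]- e, e[ -> geodesic U F (fun t => H (s, t))
      & forall t : R, t \in `[0, 1] -> J t = 'D_(1, 0) H (0, t)].

Definition conjugate_points U F (a b : 'cV[R]_d) : Prop :=
  exists g J : R -> 'cV[R]_d,
    [/\ geodesic U F g, g 0 = a /\ g 1 = b, jacobi_field U F g J,
        J 0 = 0 /\ J 1 = 0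
      & exists2 t : R, t \in `[0, 1] & J t != 0].

End Finsler.

(* A tuple (x_0, ..., x_T) or (u_0, ..., u_(T-1)) is represented by a sequence
   [nat -> 'cV_d] of which only the entries of index [<= T], resp. [< T], are
   ever constrained or used. *)
Section Discretized.
Context (R : realType) (d : nat) (U : set 'cV[R]_d)
  (F : 'cV[R]_d -> 'cV[R]_d -> R) (T : nat) (a b : 'cV[R]_d).
Implicit Types (x u : nat -> 'cV[R]_d).

(* At [u t = 0], where [fundamental_tensor] has a meaningless value, the summand
   is 0, which is the value of [F (x t) (u t) ^+ 2]. *)
Definition energy x u : R := \sum_(t < T) quad F (x t) (u t) (u t).

Definition feasible x u : Prop :=
  [/\ forall t, (t <= T)%N -> U (x t),
      x 0%N = a, x T = b
    & forall t, (t < T)%N -> x t.+1 = x t + u t].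

(* Global minimum points are in particular local ones. *)
Definition local_min x u : Prop :=
  feasible x u /\
  exists2 e : R, 0 < e & forall y w, feasible y w ->
    (forall t, (t <= T)%N -> `|y t - x t| < e) ->
    (forall t, (t < T)%N -> `|w t - u t| < e) ->
    energy x u <= energy y w.

(* The derivative of the energy vanishes along every direction [(dx, du)]
   tangent to the affine constraints. *)
Definition critical_point x u : Prop :=
  feasible x u /\
  forall dx du : nat -> 'cV[R]_d,
    dx 0%N = 0 -> dx T = 0 ->
    (forall t, (t < T)%N -> dx t.+1 = dx t + du t) ->
    is_derive (0 : R) 1
      (fun s : R => energy (fun t => x t + s *: dx t) (fun t => u t + s *: du t))
      0.

Section Update.
Variables x u : nat -> 'cV[R]_d.

Definition Gt (t : nat) : 'M[R]_d := fundamental_tensor F (x t) (u t).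

Definition nu (t : nat) : 'cV[R]_d :=
  grad (fun y => quad F y (u t) (u t)) (x t).

Definition zeta (t : nat) : 'cV[R]_d :=
  grad (fun y => quad F (x t) y (u t)) (u t).

Definition zeta_nu (t : nat) : 'cV[R]_d :=
  zeta t + \sum_(t.+1 <= j < T) nu j.

Definition mu : 'cV[R]_d :=
  invmx (\sum_(t < T) invmx (Gt t)) *m
    (2 *: (a - b) - \sum_(t < T) invmx (Gt t) *m zeta_nu t).

Definition utilde (t : nat) : 'cV[R]_d :=
  - 2^-1 *: (invmx (Gt t) *m (mu + zeta_nu t)).

Definition ustep (alpha : R) (t : nat) : 'cV[R]_d :=
  alpha *: utilde t + (1 - alpha) *: u t.

Fixpoint xstep (alpha : R) (t : nat) : 'cV[R]_d :=
  if t is s.+1 then xstep alpha s + ustep alpha s else a.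

Definition in_chart (alpha : R) : Prop :=
  forall t, (t <= T)%N -> U (xstep alpha t).

Definition exact_line_search (alpha : R) : Prop :=
  in_chart alpha /\
  forall beta, in_chart beta ->
    energy (xstep alpha) (ustep alpha) <= energy (xstep beta) (ustep beta).

End Update.

(* One iteration, from [(x, u)] to [(x', u')]. It is a relation because the
   exact line search may have several minimizers. *)
Definition georce_step x u x' u' : Prop :=
  exists2 alpha, exact_line_search x u alpha &
    [/\ forall t, (t < T)%N -> u' t = ustep x u alpha t,
        x' 0%N = a
      & forall t, (t < T)%N -> x' t.+1 = x' t + u' t].

End Discretized.

(* Main.v *)
Require Import Defs.
From HB Require Import structures.
From mathcomp Require Import all_boot all_order all_algebra.
From mathcomp Require Import all_classical all_reals.
From mathcomp Require Import topology normedtype derive sequences.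
From mathcomp Require Import ring lra.
Import Order.TTheory GRing.Theory Num.Theory.
Import numFieldNormedType.Exports.
Local Open Scope classical_set_scope.
Local Open Scope ring_scope.
Set Implicit Arguments.
Unset Strict Implicit.
Unset Printing Implicit Defensive.

(* The energies of the iterates decrease, hence converge.  Along an ultrafilter
   finer than [\oo] the points [x_t], the directions [u_t / |u_t|] and the
   lengths [|u_t|] converge as well: bounded energy bounds [u_t] as soon as
   [x_t] converges in the chart.  The tensor [G] is 0-homogeneous in the
   velocity, so [G_t] converges to a positive definite matrix even if the limit
   velocity vanishes; [zeta_t] vanishes by Euler's relation, and [nu_t]
   converges by 2-homogeneity.  Therefore [utilde_t] converges, and by summation
   by parts the derivative of the energy at the limit along
   [delta = utilde - u] is [- 2 \sum_t delta_t^T G_t delta_t].  If [delta] were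
   not zero, a fixed step size would bring some iterate below the limit energy,
   against the exact line search; and [delta = 0] says that the limit is a
   critical point. *)

(** * Convergence of matrices *)

Section Limits.
Context {R : realType} {I : Type} {F : set_system I} {FF : ProperFilter F}.

Lemma cvg_mxP m n (A : I -> 'M[R]_(m, n)) (B : 'M[R]_(m, n)) :
  A @ F --> B <-> forall i j, A k i j @[k --> F] --> B i j.
Proof.
split=> [AB i j|AB].
  exact: (cvg_comp _ _ AB (@coord_continuous _ _ _ i j B)).
move=> S [P BP PS].
suff : \forall k \near F, forall ij : 'I_m * 'I_n, P ij.1 ij.2 (A k ij.1 ij.2).
  by apply: filterS => k Pk; apply: PS => i j; exact: (Pk (i, j)).
by apply: filter_forall => -[i j]; exact: (AB i j _ (BP i j)).
Qed.

Lemma cvg_bigsum (V : normedModType R) (J : Type) (r : seq J) (P : pred J)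
    (f : J -> I -> V) (l : J -> V) :
  (forall j, P j -> f j @ F --> l j) ->
  (\sum_(j <- r | P j) f j k) @[k --> F] --> \sum_(j <- r | P j) l j.
Proof.
move=> fl; elim: r => [|j r IH].
  by under eq_fun do rewrite big_nil; rewrite big_nil; exact: cvg_cst.
under eq_fun do rewrite big_cons; rewrite big_cons.
by case: ifP => // Pj; apply: cvgD => //; exact: fl.
Qed.

Lemma cvg_bigprod (J : Type) (r : seq J) (P : pred J)
    (f : J -> I -> R) (l : J -> R) :
  (forall j, P j -> f j @ F --> l j) ->
  (\prod_(j <- r | P j) f j k) @[k --> F] --> \prod_(j <- r | P j) l j.
Proof.
move=> fl; elim: r => [|j r IH].
  by under eq_fun do rewrite big_nil; rewrite big_nil; exact: cvg_cst.
under eq_fun do rewrite big_cons; rewrite big_cons.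
by case: ifP => // Pj; apply: cvgM => //; exact: fl.
Qed.

Lemma cvg_mulmx m n p (A : I -> 'M[R]_(m, n)) (B : I -> 'M[R]_(n, p))
    (A' : 'M[R]_(m, n)) (B' : 'M[R]_(n, p)) :
  A @ F --> A' -> B @ F --> B' -> (A k *m B k) @[k --> F] --> A' *m B'.
Proof.
move=> /cvg_mxP cA /cvg_mxP cB; apply/cvg_mxP => i j.
under eq_fun do rewrite mxE; rewrite mxE.
by apply: cvg_bigsum => l _; apply: cvgM.
Qed.

Lemma cvg_det n (A : I -> 'M[R]_n) (A' : 'M[R]_n) :
  A @ F --> A' -> (\det (A k)) @[k --> F] --> \det A'.
Proof.
move=> /cvg_mxP cA; rewrite /determinant; apply: cvg_bigsum => s _.
by apply: cvgM; [exact: cvg_cst|apply: cvg_bigprod].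
Qed.

(** Cramer's formula: determinant and cofactors are polynomials in the entries, and the limit
    determinant is nonzero. *)
Lemma cvg_invmx n (A : I -> 'M[R]_n) (A' : 'M[R]_n) : A' \in unitmx ->
  A @ F --> A' -> (invmx (A k)) @[k --> F] --> invmx A'.
Proof.
move=> uA' cA.
have cd : (\det (A k)) @[k --> F] --> \det A' by exact: cvg_det.
have d0 : \det A' != 0 by rewrite -unitfE -unitmxE.
rewrite {2}/invmx uA'.
have : ((\det (A k))^-1 *: \adj (A k)) @[k --> F] --> (\det A')^-1 *: \adj A'.
  apply: cvgZ; first exact: cvgV.
  apply/cvg_mxP => i j; under eq_fun do rewrite mxE; rewrite mxE /cofactor.
  apply: cvgM; first exact: cvg_cst.
  apply: cvg_det; apply/cvg_mxP => i' j'.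
  under eq_fun do rewrite !mxE; rewrite !mxE.
  by move/cvg_mxP: cA; exact.
(* [invmx] returns its argument on singular matrices, so Cramer's formula is only available
   eventually, once the determinant of [A k] is nonzero. *)
apply: cvg_trans; apply: near_eq_cvg.
near=> k; rewrite /invmx unitmxE unitfE ifT //.
by near: k; exact: cvgr_neq0 cd d0.
Unshelve. all: by end_near.
Qed.

End Limits.

(** * Limits of bounded families along an ultrafilter *)

Section Ultra.
Context {R : realType} {I : Type} {F : set_system I} {FU : UltraFilter F}.

(** Maximality: if a finer proper filter contained [A] while the preimage of [A] is not in [F], it
    would contain the complement of [A] as well. *)
Lemma ultra_fmap T (f : I -> T) : UltraFilter (f @ F).
Proof.
split=> [|G GF fFG]; first exact: fmap_proper_filter.
rewrite eqEsubset; split=> // A GA.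
have [//|FnA] := in_ultra_setVsetC (f @^-1` A) FU.
have GnA : G (~` A) by exact: fFG.
by have /filter_ex [y []] : G (A `&` ~` A) by exact: filterI.
Qed.

(** Compactness of a segment in its ultrafilter form; it takes the place of extracting
    subsequences. *)
Lemma ultra_bounded_cvg (f : I -> R) (M : R) :
  (\forall k \near F, `|f k| <= M) -> exists l : R, f @ F --> l.
Proof.
move=> fM; have := @segment_compact R (- M) M.
rewrite compact_ultra => /(_ (f @ F) (ultra_fmap f)) [|l [_ fl]]; last by exists l.
by apply: filterS fM => k; rewrite /= in_itv /= ler_norml.
Qed.

Lemma ler_coord_norm m n (A : 'M[R]_(m, n)) i j : `|A i j| <= `|A|.
Proof.
by rewrite [leRHS]/Num.Def.normr/= mx_normrE; exact: (le_bigmax _ _ (i, j)).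
Qed.

Lemma ultra_bounded_cvg_mx m n (A : I -> 'M[R]_(m, n)) (M : R) :
  (\forall k \near F, `|A k| <= M) -> exists l : 'M[R]_(m, n), A @ F --> l.
Proof.
move=> AM.
have c i j : exists l : R, A k i j @[k --> F] --> l.
  apply: (@ultra_bounded_cvg (fun k => A k i j) M); apply: filterS AM => k.
  exact/le_trans/ler_coord_norm.
pose l i j := sval (cid (c i j)).
exists (\matrix_(i, j) l i j); apply/cvg_mxP => i j; rewrite mxE.
exact: svalP (cid (c i j)).
Qed.

End Ultra.

(** * Directional derivatives of C^1 functions *)

Section Directional.
Context {R : realType} {V : normedModType R}.
Implicit Types (D : set V) (f g : V -> R) (p v w : V).

(** C^1 in the directional sense: each derivative is continuous in the point for a fixed direction.
    Linearity in the direction is proved below from this. *)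
Definition C1_on D f := forall p, D p ->
  {for p, continuous f} /\
  forall v, derivable f p v /\ {for p, continuous ('D_v f)}.

Lemma is_derive_val f p v (df : R) : is_derive p v f df -> 'D_v f p = df.
Proof. by case. Qed.

(** The quotients agree as functions of [h], so existence and value of the derivative transfer
    together. *)
Lemma line_quotient f p v (s : R) :
  (fun h : R => h^-1 *:
     (((fun s : R => f (p + s *: v)) \o shift s) (h *: 1) - f (p + s *: v))) =
  (fun h : R => h^-1 *: ((f \o shift (p + s *: v)) (h *: v) - f (p + s *: v))).
Proof.
apply/funext => h /=; do 3 f_equal.
by rewrite [h *: 1]mulr1 scalerDl addrCA.
Qed.

Lemma is_derive_line f p v (s df : R) :
  is_derive (p + s *: v) v f df ->
  is_derive s 1 (fun s : R => f (p + s *: v)) df.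
Proof.
move=> [d e]; split; first by rewrite /derivable line_quotient.
by rewrite -e /derive line_quotient.
Qed.

Lemma is_derive_lineP f p v (df : R) :
  is_derive (0 : R) 1 (fun s : R => f (p + s *: v)) df <-> is_derive p v f df.
Proof.
split=> [[]|pv]; last by apply: is_derive_line; rewrite scale0r addr0.
rewrite /derivable /derive line_quotient scale0r addr0 => d e.
by split.
Qed.

(** On the line through [p], [f] is a function of one real variable, whose differential is linear;
    this covers every real [c], zero included. *)
Lemma is_deriveZ_dir f p v (c df : R) :
  is_derive p v f df -> is_derive p (c *: v) f (c * df).
Proof.
move=> /is_derive_lineP; set g := fun s : R => _ => -[gd <-].
have gdiff : differentiable g 0 by apply/derivable1_diffP.
have -> : c * 'D_1 g 0 = 'D_c g 0.
  have c1 : c = c *: (1 : R^o) by rewrite [RHS]mulr1.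
  by rewrite !deriveE // {2}c1 linearZ.
have q : (fun h : R => h^-1 *: ((g \o shift 0) (h *: c) - g 0)) =
         (fun h : R => h^-1 *: ((f \o shift p) (h *: (c *: v)) - f p)).
  apply/funext => h; rewrite /g /= addr0 scale0r addr0 scalerA.
  by rewrite [p + _]addrC.
split; last by rewrite /derive q.
rewrite /derivable -q; exact: diff_derivable.
Qed.

(** The increment along [h (v + w)] is split into a step along [h v], then one along [h w]. By the
    mean value theorem the second is [h] times ['D_w f] at an intermediate point, which tends to
    [p]. *)
Lemma is_deriveD_dir D f p v w : open D -> C1_on D f -> D p ->
  is_derive p (v + w) f ('D_v f p + 'D_w f p).
Proof.
move=> oD C1f Dp.
suff cv : h^-1 *: ((f \o shift p) (h *: (v + w)) - f p) @[h --> (0 : R)^'] -->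
    ('D_v f p + 'D_w f p : R).
  by split; [apply/cvg_ex; exists ('D_v f p + 'D_w f p)|exact: cvg_lim].
have -> : (fun h : R => h^-1 *: ((f \o shift p) (h *: (v + w)) - f p)) =
  (fun h : R => h^-1 *: ((f \o shift p) (h *: v) - f p) +
    h^-1 *: (f (h *: (v + w) + p) - f (h *: v + p))).
  by apply/funext => h /=; rewrite -scalerDr [X in _ = _ *: X]addrC subrKA.
have [_ /(_ v) [dv _]] := C1f _ Dp.
apply: cvgD; first exact: dv.
apply/cvgrPdist_le => /= e e0.
have [_ /(_ w) [_ cw]] := C1f _ Dp.
have : \forall q \near p, D q /\ `|'D_w f p - 'D_w f q| <= e.
  apply: filterI; first exact: open_nbhs_nbhs.
  by move/cvgrPdist_le : cw; apply.
move=> /nbhs_ballP [r /= r0 rD].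
(* The segment from [p + h v] to [p + h v + h w] lies within [|h| * (|v| + |w|)] of [p]; the added 1
   makes [M] positive, so that one can divide by it. *)
pose M := `|v| + `|w| + 1.
have M0 : 0 < M by rewrite ltr_pwDr // addr_ge0.
near=> h.
have hM : `|h| * M < r.
  rewrite -ltr_pdivlMr //; near: h; apply: dnbhs0_lt; exact: divr_gt0.
have h0 : h != 0 by near: h; exact: nbhs_dnbhs_neq.
pose q (s : R) := (h *: v + p) + s *: (h *: w).
have qb (s : R) : 0 <= s <= 1 -> D (q s) /\ `|'D_w f p - 'D_w f (q s)| <= e.
  move=> /andP[s0 s1]; apply: rD; rewrite -ball_normE /= /q.
  rewrite -addrA addrCA opprD addrA subrr add0r normrN.
  apply: le_lt_trans (ler_normD _ _) _; rewrite !normrZ.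
  apply: le_lt_trans hM.
  rewrite /M !mulrDr mulr1 -addrA lerD2l (ger0_norm s0).
  apply: ler_wpDr => //; apply: ler_piMl => //; exact: mulr_ge0.
have dq (s : R) : 0 <= s <= 1 ->
    is_derive s (1 : R) (fun s : R => f (q s)) (h * 'D_w f (q s)).
  move=> /qb [Dq _]; apply: is_derive_line; apply: is_deriveZ_dir.
  by apply: derivableP; have [_ /(_ w) []] := C1f _ Dq.
have [|||c] := @MVT_segment R (fun s => f (q s))
    (fun s => h * 'D_w f (q s)) 0 1.
- exact: ler01.
- by move=> s /[!in_itv] /= /andP[s0 s1]; apply: dq; rewrite !ltW.
- apply: derivable_within_continuous => s; rewrite in_itv /= => s01.
  by have [] := dq s s01.
rewrite in_itv /= => /qb [_ ce]; rewrite /q scale1r scale0r addr0 subr0 mulr1.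
move=> mvt; have -> : h *: (v + w) + p = h *: v + p + h *: w.
  by rewrite scalerDr addrAC.
by rewrite mvt [_ *: _]mulrA mulVf // mul1r.
Unshelve. all: by end_near. Qed.

Lemma derive_sum_dir D f p (J : Type) (r : seq J) (c : J -> R) (v : J -> V) :
  open D -> C1_on D f -> D p ->
  'D_(\sum_(j <- r) c j *: v j) f p = \sum_(j <- r) c j * 'D_(v j) f p.
Proof.
move=> oD C1f Dp; elim: r => [|j r IH]; first by rewrite !big_nil derive0.
rewrite !big_cons -IH.
have [_ ->] := is_deriveD_dir (c j *: v j) (\sum_(i <- r) c i *: v i) oD C1f Dp.
congr (_ + _); have [_ /(_ (v j)) [/derivableP + _]] := C1f _ Dp.
by move=> /(is_deriveZ_dir (c j)) [].
Qed.

Lemma C1_on_eq D f g : open D -> (forall q, D q -> f q = g q) ->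
  C1_on D f -> C1_on D g.
Proof.
move=> oD fg C1f p Dp.
have fgn q : D q -> {near q, f =1 g}.
  by move=> Dq; near=> z; apply: fg; near: z; exact: open_nbhs_nbhs.
have [cf df] := C1f _ Dp; split.
  have : g z @[z --> p] --> f p.
    by apply: cvg_trans cf; exact: near_eq_cvg (fgn _ Dp).
  by rewrite (fg _ Dp).
move=> v; have [dv cv] := df v; split.
  exact: near_eq_derivable (fgn _ Dp) dv.
suff : 'D_v g z @[z --> p] --> 'D_v f p by rewrite (near_eq_derive v (fgn _ Dp)).
apply: cvg_trans cv; apply: near_eq_cvg.
near=> z; apply: near_eq_derive; apply: fgn.
by near: z; exact: open_nbhs_nbhs.
Unshelve. all: by end_near. Qed.

Lemma derive_mul_on D f g p v : C1_on D f -> C1_on D g -> D p ->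
  'D_v (fun q => f q * g q) p = f p * 'D_v g p + g p * 'D_v f p.
Proof.
move=> C1f C1g Dp; have [_ /(_ v) [df _]] := C1f _ Dp.
by have [_ /(_ v) [dg _]] := C1g _ Dp; rewrite (deriveM df dg).
Qed.

Lemma C1_onM D f g : open D -> C1_on D f -> C1_on D g ->
  C1_on D (fun q => f q * g q).
Proof.
move=> oD C1f C1g p Dp.
have [cf df] := C1f _ Dp; have [cg dg] := C1g _ Dp.
split; first exact: cvgM.
move=> v; have [dfv cfv] := df v; have [dgv cgv] := dg v.
split; first exact: (derivableM dfv dgv).
suff : 'D_v (fun q => f q * g q) q @[q --> p] --> f p * 'D_v g p + g p * 'D_v f p.
  by rewrite -(derive_mul_on v C1f C1g Dp).
have : (f q * 'D_v g q + g q * 'D_v f q) @[q --> p] -->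
    f p * 'D_v g p + g p * 'D_v f p.
  by apply: cvgD; [exact: cvgM cf cgv|exact: cvgM cg cfv].
apply: cvg_trans; apply: near_eq_cvg; near=> q.
rewrite (derive_mul_on v C1f C1g) //.
by near: q; exact: open_nbhs_nbhs.
Unshelve. all: by end_near. Qed.

Lemma C1_on_cst D (c : R) : C1_on D (fun=> c).
Proof.
move=> p _; split; first exact: cvg_cst.
move=> v; split; first exact: derivable_cst.
rewrite (_ : 'D_v _ = fun=> 0); first exact: cvg_cst.
by apply/funext => q; rewrite derive_cst.
Qed.

Lemma smooth_C1_on D f : smooth_on D f -> C1_on D f.
Proof.
move=> sf p Dp; have [cf df] := sf [::] p Dp; split; first exact: cf.
by move=> v; split; [exact: df|have [] := sf [:: v] p Dp].
Qed.

Lemma smooth_C1_on_derive D f v : smooth_on D f -> C1_on D ('D_v f).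
Proof.
move=> sf p Dp; have [cf df] := sf [:: v] p Dp; split; first exact: cf.
by move=> w; split; [exact: df|have [] := sf [:: w; v] p Dp].
Qed.

End Directional.

(** * Partial derivatives of functions on a product *)

Section Slices.
Context {R : realType} {V W : normedModType R}.
Implicit Types (f : V * W -> R) (D : set (V * W)).

(** A partial derivative is a joint derivative in a direction with one zero component, so joint
    continuity passes to it. *)
Lemma slice1_quotient f (w y : V) (v : W) :
  (fun h : R => h^-1 *: (((fun y => f (y, v)) \o shift y) (h *: w) - f (y, v))) =
  (fun h : R => h^-1 *: ((f \o shift (y, v)) (h *: ((w, 0) : V * W)) - f (y, v))).
Proof.
apply/funext => h /=; do 3 f_equal.
by congr (_, _); rewrite /= scaler0 add0r.
Qed.

Lemma slice2_quotient f (y : V) (w v : W) :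
  (fun h : R => h^-1 *: (((fun v => f (y, v)) \o shift v) (h *: w) - f (y, v))) =
  (fun h : R => h^-1 *: ((f \o shift (y, v)) (h *: ((0, w) : V * W)) - f (y, v))).
Proof.
apply/funext => h /=; do 3 f_equal.
by congr (_, _); rewrite /= scaler0 add0r.
Qed.

Lemma derive_slice1 f (w : V) (v : W) :
  'D_w (fun y => f (y, v)) = (fun y => 'D_((w, 0) : V * W) f (y, v)).
Proof. by apply/funext => y; rewrite /derive slice1_quotient. Qed.

Lemma derive_slice2 f (y : V) (w : W) :
  'D_w (fun v => f (y, v)) = (fun v => 'D_((0, w) : V * W) f (y, v)).
Proof. by apply/funext => v; rewrite /derive slice2_quotient. Qed.

Lemma C1_on_slice1 D f (v : W) : C1_on D f ->
  C1_on [set y | D (y, v)] (fun y => f (y, v)).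
Proof.
move=> C1f y /= Dy; have [cf df] := C1f _ Dy.
have cy : (z, v) @[z --> y] --> (y, v).
  by apply: cvg_pair; [exact: cvg_id|exact: cvg_cst].
split; first exact: (cvg_comp _ _ cy cf).
move=> w; have [dw cw] := df (w, 0); split.
  by rewrite /derivable slice1_quotient.
by rewrite derive_slice1; exact: (cvg_comp _ _ cy cw).
Qed.

Lemma C1_on_slice2 D f (y : V) : C1_on D f ->
  C1_on [set v | D (y, v)] (fun v => f (y, v)).
Proof.
move=> C1f v /= Dv; have [cf df] := C1f _ Dv.
have cv : (y, z) @[z --> v] --> (y, v).
  by apply: cvg_pair; [exact: cvg_cst|exact: cvg_id].
split; first exact: (cvg_comp _ _ cv cf).
move=> w; have [dw cw] := df (0, w); split.
  by rewrite /derivable slice2_quotient.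
by rewrite derive_slice2; exact: (cvg_comp _ _ cv cw).
Qed.

End Slices.

Lemma near0_addr_gt0 {R : realType} : \forall s \near (0 : R), 0 < 1 + s.
Proof.
near=> s; have : `|s| < 1.
  by near: s; exact: (@nbhs0_lt R R^o 1 ltr01).
by rewrite ltr_norml => /andP[]; lra.
Unshelve. all: by end_near. Qed.

(** * Inner product of column vectors and gradients *)

Section Dot.
Context {R : realType} {d : nat}.
Implicit Types (p q : 'cV[R]_d).

Definition dot p q : R := (p^T *m q) 0 0.

Lemma dotE p q : dot p q = \sum_k p k 0 * q k 0.
Proof. by rewrite /dot mxE; apply: eq_bigr => k _; rewrite mxE. Qed.

Lemma dotC p q : dot p q = dot q p.
Proof. by rewrite !dotE; apply: eq_bigr => k _; rewrite mulrC. Qed.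

Lemma dotDl p p' q : dot (p + p') q = dot p q + dot p' q.
Proof. by rewrite /dot linearD mulmxDl mxE. Qed.

Lemma dotZl c p q : dot (c *: p) q = c * dot p q.
Proof. by rewrite /dot linearZ -scalemxAl mxE. Qed.

Lemma dotDr p q q' : dot p (q + q') = dot p q + dot p q'.
Proof. by rewrite dotC dotDl !(dotC p). Qed.

Lemma dotZr c p q : dot p (c *: q) = c * dot p q.
Proof. by rewrite dotC dotZl dotC. Qed.

Lemma dot0l q : dot 0 q = 0.
Proof. by rewrite -(scale0r 0) dotZl mul0r. Qed.

Lemma dot0r p : dot p 0 = 0.
Proof. by rewrite dotC dot0l. Qed.

Lemma dotBl p p' q : dot (p - p') q = dot p q - dot p' q.
Proof. by rewrite -scaleN1r dotDl dotZl mulN1r. Qed.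

Lemma dotBr p q q' : dot p (q - q') = dot p q - dot p q'.
Proof. by rewrite dotC dotBl !(dotC p). Qed.

Lemma dot_suml (J : Type) (r : seq J) (P : pred J) (f : J -> 'cV[R]_d) q :
  dot (\sum_(j <- r | P j) f j) q = \sum_(j <- r | P j) dot (f j) q.
Proof. by elim/big_rec2: _ => [|j c e _ <-]; rewrite ?dot0l ?dotDl. Qed.

Lemma dot_sumr (J : Type) (r : seq J) (P : pred J) (f : J -> 'cV[R]_d) q :
  dot q (\sum_(j <- r | P j) f j) = \sum_(j <- r | P j) dot q (f j).
Proof. by rewrite dotC dot_suml; apply: eq_bigr => j _; rewrite dotC. Qed.

Lemma col_sum_delta p : p = \sum_k p k 0 *: (delta_mx k 0 : 'cV[R]_d).
Proof.
by rewrite {1}(matrix_sum_delta p); apply: eq_bigr => k _; rewrite big_ord1.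
Qed.

Lemma is_derive_coord p v k : is_derive p v (fun q : 'cV[R]_d => q k 0) (v k 0).
Proof.
apply/is_derive_lineP.
have -> : (fun s : R => (p + s *: v) k 0) = (fun s : R => p k 0 + s * v k 0).
  by apply/funext => s; rewrite !mxE.
by apply: is_derive_eq; rewrite add0r /GRing.scale /=; ring.
Qed.

Lemma derive_grad (D : set 'cV[R]_d) (f : 'cV[R]_d -> R) p v :
  open D -> C1_on D f -> D p -> 'D_v f p = dot v (grad f p).
Proof.
move=> oD C1f Dp; rewrite {1}(col_sum_delta v) (derive_sum_dir _ _ _ oD C1f Dp).
by rewrite dotE; apply: eq_bigr => k _; rewrite /grad mxE.
Qed.

End Dot.

(** * Euler relations for Finsler metrics *)

Section FinslerFacts.
Context {R : realType} {d : nat} (U : set 'cV[R]_d)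
  (F : 'cV[R]_d -> 'cV[R]_d -> R).
Hypotheses (openU : open U) (finslerF : finsler_metric U F).
Implicit Types (x y v w : 'cV[R]_d).
Local Notation V2 := ('cV[R]_d * 'cV[R]_d)%type.

Definition sqF (p : V2) : R := F p.1 p.2 ^+ 2.
Definition slit : set V2 := [set p : V2 | U p.1 /\ p.2 != 0].
Local Notation L x := (fun v => F x v ^+ 2).
Local Notation G := (fundamental_tensor F).
Local Notation pd k := ((0, delta_mx k 0) : V2).
Local Notation pdx k := ((delta_mx k 0, 0) : V2).

Lemma open_neq0 : open [set v : 'cV[R]_d | v != 0].
Proof.
have -> : [set v : 'cV[R]_d | v != 0] = (fun v => `|v|) @^-1` [set r : R | r != 0].
  by apply/seteqP; split=> v /=; rewrite normr_eq0.
apply: open_comp; last exact: open_neq.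
by move=> v _; exact: norm_continuous.
Qed.

Lemma open_slit : open slit.
Proof.
have -> : slit = (fst @^-1` U) `&` (snd @^-1` [set v | v != 0]) by [].
apply: openI; apply: open_comp => //; try exact: open_neq0.
- by move=> p _; exact: cvg_fst.
- by move=> p _; exact: cvg_snd.
Qed.

Lemma C1_sqF : C1_on slit sqF.
Proof.
have [_ sF _ _] := finslerF.
by apply: C1_onM open_slit _ _; exact: smooth_C1_on.
Qed.

(** By the product rule the derivative is [2 * (f q * 'D_w f q)] on the open set [slit], a product
    of C^1 functions. *)
Lemma C1_derive_sqF (w : V2) : C1_on slit ('D_w sqF).
Proof.
have [_ sF _ _] := finslerF; set f := fun p : V2 => F p.1 p.2.
have C1f : C1_on slit f by exact: smooth_C1_on.
have C1d : C1_on slit ('D_w f) by exact: smooth_C1_on_derive.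
apply: (@C1_on_eq _ _ _ (fun q => 2 * (f q * 'D_w f q)) _ open_slit).
  by move=> q Dq; rewrite (derive_mul_on w C1f C1f Dq); ring.
by apply: C1_onM open_slit _ _; [exact: C1_on_cst|exact: C1_onM open_slit _ _].
Qed.

Lemma derive_finsler_sqr x w : 'D_w (L x) = (fun v => 'D_((0, w) : V2) sqF (x, v)).
Proof. exact: (derive_slice2 sqF). Qed.

Lemma derive2_finsler_sqr x w w' :
  'D_w' ('D_w (L x)) = (fun v => 'D_((0, w') : V2) ('D_((0, w) : V2) sqF) (x, v)).
Proof.
rewrite (derive_finsler_sqr x w); exact: (derive_slice2 ('D_((0, w) : V2) sqF) x w').
Qed.

Lemma C1_finsler_sqr_v x : U x -> C1_on [set v | v != 0] (L x).
Proof.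
move=> Ux v v0; apply: (C1_on_slice2 C1_sqF).
by split.
Qed.

Lemma C1_derive_finsler_sqr x w : U x -> C1_on [set v | v != 0] ('D_w (L x)).
Proof.
move=> Ux v v0; rewrite derive_finsler_sqr.
apply: (C1_on_slice2 (C1_derive_sqF (0, w))).
by split.
Qed.

Lemma C1_finsler_sqr_x v : v != 0 -> C1_on U (fun y => F y v ^+ 2).
Proof.
move=> v0 y Uy; apply: (C1_on_slice1 C1_sqF).
by split.
Qed.

Lemma finsler_sqr_hom x v c : U x -> 0 < c ->
  F x (c *: v) ^+ 2 = c ^+ 2 * F x v ^+ 2.
Proof. by move=> Ux c0; have [_ _ -> //] := finslerF; rewrite exprMn. Qed.

(** Homogeneity with factor 2 gives [F x 0 = 2 * F x 0]. *)
Lemma finsler_zero x : U x -> F x 0 = 0.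
Proof.
move=> Ux; have [_ _ h _] := finslerF.
by have := h x 0 2 Ux (ltr0n _ 2); rewrite scaler0 => ?; lra.
Qed.

(** Differentiate [F x (c (v + s w)) ^+ 2 = c ^+ 2 * F x (v + s w) ^+ 2] at [s = 0] and cancel one
    factor [c]. *)
Lemma derive_finsler_sqr_hom x v w c : U x -> v != 0 -> 0 < c ->
  'D_w (L x) (c *: v) = c * 'D_w (L x) v.
Proof.
move=> Ux v0 c0.
have cv0 : c *: v != 0 by rewrite scaler_eq0 negb_or v0 gt_eqF.
have /derivableP/(is_deriveZ_dir c)/is_derive_lineP H1 :
  derivable (L x) (c *: v) w by have [_ /(_ w) []] := C1_finsler_sqr_v Ux cv0.
have /derivableP/is_derive_lineP H2 :
  derivable (L x) v w by have [_ /(_ w) []] := C1_finsler_sqr_v Ux v0.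
have H3 : is_derive (0 : R) 1 (fun s : R => c ^+ 2 * F x (v + s *: w) ^+ 2)
   (c ^+ 2 * 'D_w (L x) v) by apply: is_deriveZ.
have e : (fun s : R => F x (c *: v + s *: (c *: w)) ^+ 2) =
         (fun s : R => c ^+ 2 * F x (v + s *: w) ^+ 2).
  apply/funext => s; rewrite -finsler_sqr_hom // scalerDr; congr (F x (_ + _) ^+ 2).
  by rewrite !scalerA mulrC.
rewrite e in H1; have := is_derive_val H1; have [_ ->] := H3 => /eqP.
rewrite expr2 -mulrA => /eqP /mulfI -> //; exact: lt0r_neq0.
Qed.

(** Euler's relation in degree 2: differentiate along the ray [(1 + s) v], where homogeneity applies
    as long as [1 + s] is positive. *)
Lemma euler_finsler_sqr x v : U x -> v != 0 -> dot v (grad (L x) v) = 2 * F x v ^+ 2.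
Proof.
move=> Ux v0; rewrite -(derive_grad _ open_neq0 (C1_finsler_sqr_v Ux) v0).
have /derivableP/is_derive_lineP H1 :
  derivable (L x) v v by have [_ /(_ v) []] := C1_finsler_sqr_v Ux v0.
have <- := is_derive_val H1.
have H2 : is_derive (0 : R) 1 (fun s : R => (1 + s) ^+ 2 * F x v ^+ 2)
   (2 * F x v ^+ 2).
  apply: is_derive_eq; rewrite /GRing.scale /=; ring.
rewrite -[RHS](is_derive_val H2); apply: near_eq_derive; near=> s.
have s0 : 0 < 1 + s.
  by near: s; exact: near0_addr_gt0.
by rewrite -finsler_sqr_hom // scalerDl scale1r.
Unshelve. all: by end_near. Qed.

(** Euler's relation in degree 1, for the first derivatives of the squared metric. *)
Lemma euler_derive_finsler_sqr x v w : U x -> v != 0 ->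
  dot v (grad ('D_w (L x)) v) = 'D_w (L x) v.
Proof.
move=> Ux v0; rewrite -(derive_grad _ open_neq0 (C1_derive_finsler_sqr w Ux) v0).
have /derivableP/is_derive_lineP H1 :
  derivable ('D_w (L x)) v v by have [_ /(_ v) []] := C1_derive_finsler_sqr w Ux v0.
have <- := is_derive_val H1.
have H2 : is_derive (0 : R) 1 (fun s : R => (1 + s) * 'D_w (L x) v)
   ('D_w (L x) v).
  apply: is_derive_eq; rewrite /GRing.scale /=; ring.
rewrite -[RHS](is_derive_val H2); apply: near_eq_derive; near=> s.
have s0 : 0 < 1 + s.
  by near: s; exact: near0_addr_gt0.
by rewrite -derive_finsler_sqr_hom // scalerDl scale1r.
Unshelve. all: by end_near. Qed.

Lemma quadE x v y : quad F x v y = dot y (G x v *m y).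
Proof. by rewrite /quad /dot mulmxA. Qed.

(** Column [j] of [G] is half the gradient of the 1-homogeneous function ['D_(delta_mx j 0) (L x)],
    to which Euler's relation applies. *)
Lemma tensor_mul_l x v y : U x -> v != 0 ->
  dot v (G x v *m y) = 2^-1 * dot y (grad (L x) v).
Proof.
move=> Ux v0; rewrite [in RHS]dotE mulr_sumr /dot mulmxA mxE.
apply: eq_bigr => j _; rewrite [grad _ _ _ _]mxE.
rewrite -(euler_derive_finsler_sqr (delta_mx j 0) Ux v0).
rewrite mxE dotE [RHS]mulrCA [LHS]mulrC; congr (_ * _); rewrite mulr_sumr.
by apply: eq_bigr => i _; rewrite !mxE; ring.
Qed.

(** Differentiating Euler's relation [sum_j v_j D_j L = 2 L] in the direction [e_i] gives
    [sum_j v_j D_i D_j L + D_i L = 2 D_i L]. *)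
Lemma tensor_mul_r x v : U x -> v != 0 -> G x v *m v = 2^-1 *: grad (L x) v.
Proof.
move=> Ux v0; apply/colP => i; rewrite !mxE.
set e := delta_mx i 0.
have dj j : is_derive v e ('D_(delta_mx j 0) (L x))
    ('D_e ('D_(delta_mx j 0) (L x)) v).
  by apply: derivableP; have [_ /(_ e) []] := C1_derive_finsler_sqr (delta_mx j 0) Ux v0.
have cj j : is_derive v e (fun z : 'cV[R]_d => z j 0) (e j 0).
  exact: is_derive_coord.
pose h (j : 'I_d) (z : 'cV[R]_d) := z j 0 * 'D_(delta_mx j 0) (L x) z.
have H1 := is_derive_sum (fun j => is_deriveM (cj j) (dj j)).
have e1 : {near v, (\sum_j h j) =1 (fun z => 2 * F x z ^+ 2)}.
  near=> z; rewrite -euler_finsler_sqr //; last first.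
    by near: z; apply: (open_nbhs_nbhs (conj open_neq0 v0)).
  by rewrite dotE fct_sumE; apply: eq_bigr => j _; rewrite /h /grad mxE.
have H2 := near_eq_is_derive e1 H1.
have H3 : is_derive v e (fun z => 2 * F x z ^+ 2) (2 * 'D_e (L x) v).
  apply: is_deriveZ; apply: derivableP.
  by have [_ /(_ e) []] := C1_finsler_sqr_v Ux v0.
have := is_derive_val H2; rewrite (is_derive_val H3) big_split /=.
rewrite [X in _ = _ + X](_ : _ = 'D_e (L x) v); last first.
  rewrite (bigD1 i) //= /e mxE !eqxx [_ *: _]mulr1 big1 ?addr0 // => j ji.
  by rewrite mxE (negPf ji) [_ *: _]mulr0.
rewrite mulr_natl mulr2n => /addIr ->; rewrite mulr_sumr; apply: eq_bigr => j _.
by rewrite !mxE [_ *: _]mulrC mulrA.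
Unshelve. all: by end_near. Qed.

(** Away from 0 this is Euler's relation again; at [v = 0] both sides vanish, whatever the tensor is
    there. *)
Lemma quad_sqr x v : U x -> quad F x v v = F x v ^+ 2.
Proof.
move=> Ux; have [->|v0] := eqVneq v 0.
  by rewrite quadE dot0l finsler_zero // expr0n.
by rewrite quadE tensor_mul_r // dotZr euler_finsler_sqr // mulKf // pnatr_eq0.
Qed.

Lemma finsler_sqr_gt0 x v : U x -> v != 0 -> 0 < F x v ^+ 2.
Proof. by move=> Ux v0; rewrite -quad_sqr //; have [_ _ _ ->] := finslerF. Qed.

Lemma finsler_sqr_hom_ge0 x v c : U x -> 0 <= c ->
  F x (c *: v) ^+ 2 = c ^+ 2 * F x v ^+ 2.
Proof.
move=> Ux; rewrite le_eqVlt => /predU1P[<-|c0]; last exact: finsler_sqr_hom.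
by rewrite scale0r finsler_zero // expr0n mul0r.
Qed.

(** First derivatives of the squared metric are 1-homogeneous; differentiating once more along [c e]
    lowers the degree to 0. *)
Lemma tensor_hom x v c : U x -> v != 0 -> 0 < c -> G x (c *: v) = G x v.
Proof.
move=> Ux v0 c0; apply/matrixP => i j; rewrite [LHS]mxE [RHS]mxE.
set e := delta_mx i 0; set g := 'D_(delta_mx j 0) (L x).
suff -> : 'D_e g (c *: v) = 'D_e g v by [].
have cv0 : c *: v != 0 by rewrite scaler_eq0 negb_or v0 gt_eqF.
have C1g : C1_on [set v | v != 0] g by exact: C1_derive_finsler_sqr.
have /derivableP/(is_deriveZ_dir c)/is_derive_lineP H1 :
  derivable g (c *: v) e by have [_ /(_ e) []] := C1g _ cv0.
have dg : derivable g v e by have [_ /(_ e) []] := C1g _ v0.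
have gc : {near v, (fun z => c * g z) =1 (fun z => g (c *: z))}.
  near=> z; rewrite /g derive_finsler_sqr_hom //.
  by near: z; apply: (open_nbhs_nbhs (conj open_neq0 v0)).
have /is_derive_lineP H4 : is_derive v e (fun z => g (c *: z)) (c * 'D_e g v).
  exact: near_eq_is_derive gc (is_deriveZ _ (derivableP dg)).
have ee : (fun s : R => g (c *: v + s *: (c *: e))) =
          (fun s : R => g (c *: (v + s *: e))).
  by apply/funext => s; rewrite scalerDr !scalerA [s * c]mulrC.
rewrite ee in H1; have := is_derive_val H1; rewrite (is_derive_val H4).
move: ('D_e g (c *: v)) ('D_e g v) => A B.
by move=> /(mulfI (lt0r_neq0 c0)) ->.
Unshelve. all: by end_near. Qed.

Section Convergence.
Context {I : Type} {Fi : set_system I} {FF : ProperFilter Fi}.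
Variables (X W : I -> 'cV[R]_d) (x w : 'cV[R]_d).
Hypotheses (Ux : U x) (w0 : w != 0) (Xx : X @ Fi --> x) (Ww : W @ Fi --> w).

Let cXW : (X k, W k) @[k --> Fi] --> (x, w).
Proof. exact: (cvg_pair Xx Ww). Qed.

Lemma cvg_tensor : G (X k) (W k) @[k --> Fi] --> G x w.
Proof.
apply/cvg_mxP => i j.
have eG y v : G y v i j = 2^-1 * 'D_(pd i) ('D_(pd j) sqF) (y, v).
  have e2 : 'D_(delta_mx i 0) ('D_(delta_mx j 0) (L y)) v =
    'D_(pd i) ('D_(pd j) sqF) (y, v).
    exact: (congr1 (fun h : 'cV[R]_d -> R => h v)
      (derive2_finsler_sqr y (delta_mx j 0) (delta_mx i 0))).
  by rewrite mxE e2.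
under eq_fun do rewrite eG; rewrite eG.
apply: cvgM; first exact: cvg_cst.
have [_ /(_ (pd i)) [_ c]] := C1_derive_sqF (pd j) (conj Ux w0 : slit (x, w)).
exact: (cvg_comp _ _ cXW c).
Qed.

Lemma cvg_finsler_sqr : F (X k) (W k) ^+ 2 @[k --> Fi] --> F x w ^+ 2.
Proof.
have [c _] := C1_sqF (conj Ux w0 : slit (x, w)).
exact: (cvg_comp _ _ cXW c).
Qed.

Lemma cvg_grad_x :
  grad (fun y => F y (W k) ^+ 2) (X k) @[k --> Fi] --> grad (fun y => F y w ^+ 2) x.
Proof.
apply/cvg_mxP => i j.
have eG y v : grad (fun y => F y v ^+ 2) y i j = 'D_(pdx i) sqF (y, v).
  rewrite mxE; exact: (congr1 (fun h : 'cV[R]_d -> R => h y)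
    (derive_slice1 sqF (delta_mx i 0) v)).
under eq_fun do rewrite eG; rewrite eG.
have [_ /(_ (pdx i)) [_ c]] := C1_sqF (conj Ux w0 : slit (x, w)).
exact: (cvg_comp _ _ cXW c).
Qed.

End Convergence.

Lemma quad_expand x y e (h : R) : U x -> y != 0 ->
  quad F x y (y - h *: e) =
  F x y ^+ 2 - h * dot e (grad (L x) y) + h ^+ 2 * quad F x y e.
Proof.
move=> Ux y0.
have tl := tensor_mul_l e Ux y0.
have tr : dot e (G x y *m y) = 2^-1 * dot e (grad (L x) y).
  by rewrite (tensor_mul_r Ux y0) dotZr.
rewrite quadE mulmxBr -scalemxAr dotBl !dotBr !dotZl !dotZr.
rewrite tl tr -(quadE x y y) (quad_sqr y Ux) -(quadE x y e).
by field.
Qed.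

(* With [y = u + h e] and [u = y - h e], the two Euler relations
   [v^T G(x, v) = (G(x, v) v)^T = (1/2) grad_v F^2] give
   the expansion [quad_expand] of [u^T G(x, y) u], so that
   no third derivative is needed. *)
Lemma grad_quad_v x u : U x -> u != 0 -> grad (fun y => quad F x y u) u = 0.
Proof.
move=> Ux u0; apply/colP => i; rewrite !mxE; set e := delta_mx i 0.
apply: cvg_lim; first exact: Rhausdorff.
have cy : (h *: e + u) @[h --> (0 : R)^'] --> u.
  have H0 : (h *: e + u) @[h --> (0 : R)] --> 0 *: e + u.
    by apply: cvgD; [apply: cvgZr_tmp; exact: cvg_id|exact: cvg_cst].
  rewrite scale0r add0r in H0; apply: cvg_trans H0; apply: cvg_fmap2.
  exact: nbhs_dnbhs.
have C1u := C1_finsler_sqr_v Ux u0.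
have [_ /(_ e) [de ce]] := C1u.
(* By [quad_expand] the difference quotient is this expression: its first two terms both tend to
   ['D_e (L x) u] and cancel, the last is of order [h]. *)
have H : (h^-1 *: ((L x \o shift u) (h *: e) - L x u)
    - 'D_e (L x) (h *: e + u) + h * quad F x (h *: e + u) e) @[h --> (0 : R)^']
    --> 'D_e (L x) u - 'D_e (L x) u + 0 * quad F x u e.
  apply: cvgD.
    apply: cvgB; first exact: de.
    exact: (cvg_comp _ _ cy ce).
  apply: cvgM; first exact: nbhs_dnbhs.
  rewrite quadE; under eq_fun do rewrite quadE.
  have : (e^T *m (G x (h *: e + u) *m e)) @[h --> (0 : R)^'] -->
      (e^T *m (G x u *m e)).
    apply: cvg_mulmx; first exact: cvg_cst.
    apply: cvg_mulmx; last exact: cvg_cst.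
    by apply: cvg_tensor => //; exact: cvg_cst.
  by move=> /cvg_mxP /(_ 0 0).
rewrite subrr mul0r addr0 in H; apply: cvg_trans H.
apply: near_eq_cvg; near=> h.
have h0 : h != 0 by near: h; exact: nbhs_dnbhs_neq.
have y0 : h *: e + u != 0 by near: h; exact: (cvgr_neq0 _ cy u0).
rewrite /= quad_sqr // -/e; set y := h *: e + u.
rewrite (derive_grad e open_neq0 (C1_finsler_sqr_v Ux) y0).
have ue : u = y - h *: e by rewrite /y addrAC subrr add0r.
have -> : quad F x y u =
    F x y ^+ 2 - h * dot e (grad (L x) y) + h ^+ 2 * quad F x y e.
  by rewrite [in LHS]ue; exact: quad_expand.
move: (F x y ^+ 2) (F x u ^+ 2) (dot e _) (quad F x y e) => A B C D.
rewrite /GRing.scale /=; field.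
Unshelve. all: by end_near. Qed.

(** Near [x] the quadratic form equals [c ^+ 2 * F y w ^+ 2]. With [c] the length and [w] the
    direction of a velocity, the gradient is separated from the length. *)
Lemma grad_quad_x x w c : U x -> w != 0 -> 0 <= c ->
  grad (fun y => quad F y (c *: w) (c *: w)) x =
  c ^+ 2 *: grad (fun y => F y w ^+ 2) x.
Proof.
move=> Ux w0 c0; apply/colP => i; rewrite !mxE.
have [_ /(_ (delta_mx i 0)) [dw _]] := C1_finsler_sqr_x w0 Ux.
have -> : c ^+ 2 * 'D_(delta_mx i 0) (fun y => F y w ^+ 2) x =
    'D_(delta_mx i 0) (fun y => c ^+ 2 * F y w ^+ 2) x.
  exact: (esym (deriveZ (c ^+ 2) dw)).
apply: near_eq_derive; near=> y.
have Uy : U y by near: y; exact: (open_nbhs_nbhs (conj openU Ux)).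
by rewrite quad_sqr // finsler_sqr_hom_ge0.
Unshelve. all: by end_near. Qed.

(** For [r > 0], pulling out [r ^+ 2] moves the base point to [(x, w)], where the squared metric is
    C^1. For [r = 0] the function is of order [s ^+ 2], so its derivative is 0. *)
Lemma is_derive_finsler_sqr x w r dx dv : U x -> w != 0 -> 0 <= r ->
  is_derive (0 : R) 1
    (fun s : R => F (x + s *: dx) (r *: w + s *: dv) ^+ 2)
    (r ^+ 2 * dot dx (grad (fun y => F y w ^+ 2) x) +
     dot dv (2 *: (G x w *m (r *: w)))).
Proof.
move=> Ux w0 r0.
have cx : (x + s *: dx) @[s --> (0 : R)] --> x.
  rewrite -[X in _ --> X]addr0 -[X in _ + X](scale0r dx).
  by apply: cvgD; [exact: cvg_cst|apply: cvgZr_tmp; exact: cvg_id].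
have nU : \forall s \near (0 : R), U (x + s *: dx).
  by apply: cx; exact: (open_nbhs_nbhs (conj openU Ux)).
move: r0; rewrite le_eqVlt => /predU1P[<-|r0]; last first.
  have sxw : slit (x, w) by split.
  have H1 : is_derive ((x, w) : V2) ((dx, r^-1 *: dv) : V2) sqF
     (dot dx (grad (fun y => F y w ^+ 2) x) + r^-1 * dot dv (grad (L x) w)).
    have := is_deriveD_dir ((dx, 0) : V2) ((0, r^-1 *: dv) : V2)
      open_slit C1_sqF sxw.
    have -> : ((dx, 0) : V2) + ((0, r^-1 *: dv) : V2) = (dx, r^-1 *: dv).
      by congr (_, _); rewrite /= ?addr0 ?add0r.
    rewrite -[in X in X -> _](_ : 'D_dx (fun y => F y w ^+ 2) x =
        'D_((dx, 0) : V2) sqF (x, w)); last first.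
      exact: (congr1 (fun h : 'cV[R]_d -> R => h x) (derive_slice1 sqF dx w)).
    rewrite -[in X in X -> _](_ : 'D_(r^-1 *: dv) (L x) w =
        'D_((0, r^-1 *: dv) : V2) sqF (x, w)); last first.
      exact: (congr1 (fun h : 'cV[R]_d -> R => h w)
        (derive_slice2 sqF x (r^-1 *: dv))).
    rewrite (derive_grad _ openU (C1_finsler_sqr_x w0) Ux).
    by rewrite (derive_grad _ open_neq0 (C1_finsler_sqr_v Ux) w0) dotZl.
  move/is_derive_lineP : H1 => /(is_deriveZ (r ^+ 2)) H1.
  have e : {near (0 : R),
      (r ^+ 2 \*: (fun s : R => sqF ((x, w) + s *: ((dx, r^-1 *: dv) : V2))))
      =1 (fun s : R => F (x + s *: dx) (r *: w + s *: dv) ^+ 2)}.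
    near=> s; rewrite /sqF /=.
    have Us : U (x + s *: dx) by near: s; exact: nU.
    have es : r *: (w + s *: (r^-1 *: dv)) = r *: w + s *: dv.
      by rewrite scalerDr !scalerA; congr (_ + _ *: _); field; rewrite gt_eqF.
    by rewrite -es finsler_sqr_hom.
  have := near_eq_is_derive e H1; congr is_derive.
  rewrite -scalemxAr tensor_mul_r // !dotZr /GRing.scale /=.
  by field; rewrite gt_eqF.
rewrite expr0n /= mul0r scale0r mulmx0 scaler0 dot0r addr0.
suff H : h^-1 *: (((fun s : R => F (x + s *: dx) (0 + s *: dv) ^+ 2) \o shift 0)
    (h *: 1) - F (x + 0 *: dx) (0 + 0 *: dv) ^+ 2) @[h --> (0 : R)^'] --> (0 : R).
  by split; [apply/cvg_ex; exists (0 : R)|apply: cvg_lim => //; exact: Rhausdorff].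
have [->|dv0] := eqVneq dv 0.
  apply: cvg_near_cst; near=> h.
  rewrite /= !scaler0 !addr0 scale0r addr0 finsler_zero //.
  rewrite finsler_zero ?expr0n ?subrr ?scaler0 //.
  by rewrite [_ *: 1]mulr1; near: h; exact: nbhs_dnbhs.
have dvN0 : - dv != 0 by rewrite oppr_eq0.
(* Homogeneity holds for positive factors only: the sign of [h] selects [dv] or [- dv], and the sum
   of both values dominates either one. *)
pose B (h : R) := `|h| * (F (x + h *: dx) dv ^+ 2 + F (x + h *: dx) (- dv) ^+ 2).
have cx' : (x + s *: dx) @[s --> (0 : R)^'] --> x.
  by apply: cvg_trans cx; apply: cvg_fmap2; exact: nbhs_dnbhs.
have B0 : B h @[h --> (0 : R)^'] --> 0.
  rewrite -[X in _ --> X](mul0r (F x dv ^+ 2 + F x (- dv) ^+ 2)).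
  apply: cvgM.
    by rewrite -[X in _ --> X](normr0 R); apply: cvg_norm; exact: nbhs_dnbhs.
  by apply: cvgD; apply: cvg_finsler_sqr => //; exact: cvg_cst.
apply/norm_cvg0P; apply: (squeeze_cvgr _ (cvg_cst 0) B0).
near=> h; rewrite normr_ge0 /=.
have Us : U (x + h *: dx) by near: h; exact: nbhs_dnbhs.
have h0 : h != 0 by near: h; exact: nbhs_dnbhs_neq.
rewrite [h *: 1]mulr1 !scale0r !addr0 !add0r (finsler_zero Ux) expr0n /= subr0.
rewrite /B normrM normfV (ger0_norm (sqr_ge0 _)).
have [hp|hn] := ltP 0 h.
  rewrite finsler_sqr_hom // (gtr0_norm hp) expr2 -!mulrA mulKf //.
  by rewrite ler_pM2l // lerDl sqr_ge0.
have hn' : 0 < - h by rewrite oppr_gt0 lt_neqAle h0.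
rewrite -[h *: dv]opprK -scaleNr -scalerN.
rewrite finsler_sqr_hom // (ler0_norm hn) expr2 -!mulrA mulKf ?oppr_eq0 //.
by rewrite ler_pM2l // lerDr sqr_ge0.
Unshelve. all: by end_near. Qed.

End FinslerFacts.

(** * Directions and lengths of velocities along an ultrafilter *)

Section UltraFinsler.
Context {R : realType} {d : nat} (U : set 'cV[R]_d)
  (F : 'cV[R]_d -> 'cV[R]_d -> R).
Hypotheses (openU : open U) (finslerF : finsler_metric U F).
Context {I : Type} {Fi : set_system I} {FU : UltraFilter Fi}.
Implicit Types (X V : I -> 'cV[R]_d) (x v : 'cV[R]_d).

Lemma normalizeK (v : 'cV[R]_d) : v != 0 -> `|v| *: (`|v|^-1 *: v) = v.
Proof. by move=> v0; rewrite scalerA mulfV ?scale1r // normr_eq0. Qed.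

Lemma normalize_neq0 (v : 'cV[R]_d) : v != 0 -> `|v|^-1 *: v != 0.
Proof. by move=> v0; rewrite scaler_eq0 negb_or invr_eq0 normr_eq0 v0. Qed.

Lemma norm_normalize (v : 'cV[R]_d) : v != 0 -> `| `|v|^-1 *: v| = 1.
Proof. by move=> v0; rewrite normrZ normfV normr_id mulVf // normr_eq0. Qed.

Lemma ultra_normalize V : (\forall k \near Fi, V k != 0) ->
  exists2 w : 'cV[R]_d, w != 0 & (`|V k|^-1 *: V k) @[k --> Fi] --> w.
Proof.
move=> V0.
have n1 : \forall k \near Fi, `| `|V k|^-1 *: V k| = 1.
  by apply: filterS V0 => k; exact: norm_normalize.
have [|w Ww] := ultra_bounded_cvg_mx (A := fun k => `|V k|^-1 *: V k) (M := 1).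
  by apply: filterS n1 => k ->.
exists w => //; rewrite -normr_eq0.
have -> : `|w| = 1; last exact: oner_neq0.
have c1 : `| `|V k|^-1 *: V k| @[k --> Fi] --> (1 : R).
  exact: cvg_near_cst.
exact: (cvg_unique (@Rhausdorff R) (cvg_norm Ww) c1).
Qed.

(** Only a vanishing limit velocity is delicate: there the value is [|V| ^+ 2] times the value at
    the normalized direction, which has a finite limit. *)
Lemma ultra_cvg_finsler_sqr X V x v : U x -> X @ Fi --> x -> V @ Fi --> v ->
  F (X k) (V k) ^+ 2 @[k --> Fi] --> F x v ^+ 2.
Proof.
move=> Ux Xx Vv; have [v0|v0] := eqVneq v 0; last first.
  exact: (cvg_finsler_sqr openU finslerF).
have nU : \forall k \near Fi, U (X k).
  by apply: Xx; exact: (open_nbhs_nbhs (conj openU Ux)).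
rewrite v0 (finsler_zero finslerF Ux) expr0n /=.
(* An ultrafilter decides whether [V k] is eventually zero or eventually nonzero. *)
have [V0|V0] := in_ultra_setVsetC [set k | V k = 0] FU.
  apply: cvg_near_cst; near=> k; rewrite (near V0 k) //.
  by rewrite (finsler_zero finslerF) ?expr0n //; near: k.
have {}V0 : \forall k \near Fi, V k != 0 by apply: filterS V0 => k /eqP.
have [w w0 Ww] := ultra_normalize V0.
have H : (`|V k| ^+ 2 * F (X k) (`|V k|^-1 *: V k) ^+ 2) @[k --> Fi] -->
    `|v| ^+ 2 * F x w ^+ 2.
  apply: cvgM; last exact: (cvg_finsler_sqr openU finslerF).
  by rewrite !expr2; apply: cvgM; exact: cvg_norm.
rewrite v0 normr0 expr0n /= mul0r in H; apply: cvg_trans H.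
apply: near_eq_cvg; near=> k.
have Vk0 : V k != 0 by near: k.
rewrite -(finsler_sqr_hom finslerF) ?normr_gt0 ?normalizeK //.
by near: k.
Unshelve. all: by end_near. Qed.

(** On the unit directions the squared metric has a positive limit [c], so it eventually exceeds
    [c / 2], and the energy bound [M] becomes a bound on the length. *)
Lemma ultra_velocity X V x (M : R) : U x -> X @ Fi --> x ->
  (\forall k \near Fi, V k != 0) ->
  (\forall k \near Fi, F (X k) (V k) ^+ 2 <= M) ->
  exists (w : 'cV[R]_d) (r : R), [/\ w != 0, 0 <= r,
    (`|V k|^-1 *: V k) @[k --> Fi] --> w,
    `|V k| @[k --> Fi] --> r & V @ Fi --> r *: w].
Proof.
move=> Ux Xx V0 VM; have [w w0 Ww] := ultra_normalize V0.
have c0 := finsler_sqr_gt0 openU finslerF Ux w0; set c := F x w ^+ 2 in c0.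
have nU : \forall k \near Fi, U (X k).
  by apply: Xx; exact: (open_nbhs_nbhs (conj openU Ux)).
have cL : F (X k) (`|V k|^-1 *: V k) ^+ 2 @[k --> Fi] --> c.
  exact: (cvg_finsler_sqr openU finslerF).
have c2 : c / 2 < c by rewrite ltr_pdivrMr // mulr_natr mulr2n ltrDl.
(* The bound combines [|V| ^+ 2 <= M / (c / 2)] with [|V| <= 1 + |V| ^+ 2]. *)
have [|r Vr] := @ultra_bounded_cvg _ _ Fi _ (fun k => `|V k|) (1 + M / (c / 2)).
  near=> k; rewrite normr_id.
  have Vk0 : V k != 0 by near: k.
  have Vk2 : `|V k| ^+ 2 <= M / (c / 2).
    rewrite ler_pdivlMr ?divr_gt0 //.
    apply: (@le_trans _ _ (F (X k) (V k) ^+ 2)); last by near: k.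
    rewrite -[in leRHS](normalizeK Vk0) (finsler_sqr_hom finslerF) ?normr_gt0 //.
      2: by near: k.
    rewrite ler_pM2l ?exprn_gt0 ?normr_gt0 // ltW //.
    by near: k; exact: cvgr_gt cL _ c2.
  by have := sqr_ge0 (`|V k| - 1); have := normr_ge0 (V k); nra.
exists w, r; split => //.
  by apply: (cvgr_to_ge Vr); near=> k; exact: normr_ge0.
have : (`|V k| *: (`|V k|^-1 *: V k)) @[k --> Fi] --> r *: w by exact: cvgZ.
apply: cvg_trans; apply: near_eq_cvg; near=> k.
by rewrite normalizeK //; near: k.
Unshelve. all: by end_near. Qed.

End UltraFinsler.

(** * The GEORCE update *)

Section PositiveDefinite.
Context {R : realType} {d : nat}.
Implicit Types (A : 'M[R]_d) (y z : 'cV[R]_d).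

Definition posdef A := forall y, y != 0 -> 0 < dot y (A *m y).

Lemma posdef_unit A : posdef A -> A \in unitmx.
Proof.
move=> pA; rewrite unitmxE unitfE; apply/negP => /det0P [v v0 vA].
have : v^T != 0 by apply: contra_neq v0 => /(congr1 trmx); rewrite trmxK trmx0.
by move=> /pA; rewrite /dot trmxK mulmxA vA mul0mx mxE ltxx.
Qed.

(** Substitute [y = A z] with [z = invmx A *m y]. *)
Lemma posdef_inv A : posdef A -> posdef (invmx A).
Proof.
move=> pA y y0; have uA := posdef_unit pA.
rewrite -{1}(mulKVmx uA y) dotC; apply: pA.
by apply: contra_neq y0 => e; rewrite -(mulKVmx uA y) e mulmx0.
Qed.

Lemma posdef_sum T (A : nat -> 'M[R]_d) : (0 < T)%N ->
  (forall t, (t < T)%N -> posdef (A t)) -> posdef (\sum_(t < T) A t).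
Proof.
case: T => // T _ pA y y0.
rewrite mulmx_suml dot_sumr big_ord_recl ltr_pwDl ?pA //.
by apply: sumr_ge0 => i _; rewrite ltW // pA // ltn_ord.
Qed.

End PositiveDefinite.

Section UpdateAlgebra.
Context {R : realType} {d : nat} (T : nat) (a b : 'cV[R]_d)
  (G : nat -> 'M[R]_d) (z : nat -> 'cV[R]_d).

(** [mu] and [utilde] with the tensors and adjoint vectors as free parameters, so that the same
    formulas apply at the limit point, where a velocity may vanish. *)
Definition multiplier : 'cV[R]_d :=
  invmx (\sum_(t < T) invmx (G t)) *m
    (2 *: (a - b) - \sum_(t < T) invmx (G t) *m z t).

Definition control (t : nat) : 'cV[R]_d :=
  - 2^-1 *: (invmx (G t) *m (multiplier + z t)).

Hypotheses (T0 : (0 < T)%N) (pG : forall t, (t < T)%N -> posdef (G t)).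

(** Stationarity of the Lagrangian of the quadratic subproblem, with the multiplier of the end point
    constraint. *)
Lemma control_eq t : (t < T)%N -> 2 *: (G t *m control t) = - (multiplier + z t).
Proof.
move=> tT; have uG := posdef_unit (pG tT).
rewrite /control -scalemxAr mulKVmx // scalerA.
by rewrite mulrN mulfV ?scaleN1r // pnatr_eq0.
Qed.

(** The multiplier is chosen so that the controls lead from [a] to [b]; positive definiteness makes
    the sum of inverses invertible. *)
Lemma sum_control : \sum_(t < T) control t = b - a.
Proof.
have uS : \sum_(t < T) invmx (G t) \in unitmx.
  apply/posdef_unit; apply: (@posdef_sum _ _ T (fun t => invmx (G t))) => //.
  by move=> t tT; apply/posdef_inv/pG.
rewrite /control -scaler_sumr.
under eq_bigr do rewrite mulmxDr.
rewrite big_split /= -mulmx_suml /multiplier mulKVmx // subrK.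
by rewrite scalerA mulNr mulVf ?pnatr_eq0 // scaleN1r opprB.
Qed.

End UpdateAlgebra.

Section Summation.
Context {R : realType} {d : nat}.

(* The adjoint sums [sum_(j > t) nu_j] of the algorithm come from the dependence
   of the states on the earlier controls. *)
Lemma dot_sum_by_parts T (dx du nu : nat -> 'cV[R]_d) : dx 0%N = 0 ->
  (forall t, (t < T)%N -> dx t.+1 = dx t + du t) ->
  \sum_(t < T) dot (du t) (\sum_(t.+1 <= j < T) nu j) =
  \sum_(t < T) dot (dx t) (nu t).
Proof.
move=> dx0; elim: T => [|T IH] dxS; first by rewrite !big_ord0.
have sdu t : (t <= T)%N -> \sum_(s < t) du s = dx t.
  elim: t => [|t IHt] tT; first by rewrite big_ord0.
  by rewrite big_ord_recr /= IHt ?dxS // ltnW.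
rewrite !big_ord_recr /= -IH; last by move=> t tT; apply: dxS; exact: ltnW.
rewrite big_geq // dot0r addr0 -(sdu T) // dot_suml -big_split /=.
by apply: eq_bigr => t _; rewrite big_nat_recr //= dotDr.
Qed.

Lemma sum_increments T (x u : nat -> 'cV[R]_d) :
  (forall t, (t < T)%N -> x t.+1 = x t + u t) ->
  forall t, (t <= T)%N -> x t = x 0%N + \sum_(s < t) u s.
Proof.
move=> xS; elim=> [|t IH] tT; first by rewrite big_ord0 addr0.
by rewrite big_ord_recr /= addrA -IH ?xS // ltnW.
Qed.

End Summation.

(** * One iteration: feasibility and descent *)

Section Step.
Context {R : realType} {d : nat} (U : set 'cV[R]_d)
  (F : 'cV[R]_d -> 'cV[R]_d -> R) (T : nat) (a b : 'cV[R]_d).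
Hypotheses (openU : open U) (finslerF : finsler_metric U F) (T_gt0 : (0 < T)%N).
Local Notation G := (fundamental_tensor F).
Local Notation xstep := (xstep F T a b).
Local Notation ustep := (ustep F T a b).
Local Notation utilde := (utilde F T a b).
Implicit Types (x u : nat -> 'cV[R]_d).

Lemma posdef_tensor y v : U y -> v != 0 -> posdef (G y v).
Proof.
by move=> Uy v0 z z0; rewrite -quadE; have [_ _ _ ->] := finslerF.
Qed.

Lemma energyE x u : (forall t, (t < T)%N -> U (x t)) ->
  energy F T x u = \sum_(t < T) F (x t) (u t) ^+ 2.
Proof.
move=> Ux; apply: eq_bigr => t _.
by rewrite (quad_sqr openU finslerF) //; exact: Ux.
Qed.

Lemma eq_energy x u x' u' : (forall t, (t < T)%N -> x t = x' t) ->
  (forall t, (t < T)%N -> u t = u' t) -> energy F T x u = energy F T x' u'.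
Proof. by move=> ex eu; apply: eq_bigr => t _; rewrite ex ?eu. Qed.

Section FromFeasible.
Variables x u : nat -> 'cV[R]_d.
Hypotheses (fxu : feasible U T a b x u)
  (u0 : forall t, (t < T)%N -> u t != 0).

Lemma sum_feasible : \sum_(t < T) u t = b - a.
Proof.
have [_ xa xb xS] := fxu.
by rewrite -xb (sum_increments xS (leqnn T)) xa addrAC subrr add0r.
Qed.

Lemma sum_utilde : \sum_(t < T) utilde x u t = b - a.
Proof.
have [Ux _ _ _] := fxu.
apply: (@sum_control _ _ T a b (Gt F x u) (zeta_nu F T x u) T_gt0) => t tT.
by apply: posdef_tensor; [exact/Ux/ltnW|exact: u0].
Qed.

Lemma xstepE alpha t : (t <= T)%N ->
  xstep x u alpha t = x t + alpha *: \sum_(s < t) (utilde x u s - u s).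
Proof.
have [_ xa _ xS] := fxu.
elim: t => [|t IH] tT; first by rewrite /= big_ord0 scaler0 addr0 xa.
rewrite /= IH ?(ltnW tT) // big_ord_recr /= xS // /Defs.ustep.
move: (\sum_(s < t) _) (utilde x u t) (x t) (u t) => S v y z.
by apply/colP => i; rewrite !mxE; ring.
Qed.

Lemma ustepE alpha t :
  ustep x u alpha t = u t + alpha *: (utilde x u t - u t).
Proof.
by rewrite /Defs.ustep scalerBl scale1r scalerBr addrCA.
Qed.

Section OneStep.
Variables x' u' : nat -> 'cV[R]_d.
Hypothesis step : georce_step U F T a b x u x' u'.

Lemma step_spec : exists2 alpha, exact_line_search U F T a b x u alpha &
  (forall t, (t <= T)%N -> x' t = xstep x u alpha t) /\
  (forall t, (t < T)%N -> u' t = ustep x u alpha t).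
Proof.
have [alpha ls [eu xa xS]] := step; exists alpha => //; split=> //.
elim=> [|t IH] tT; first by rewrite xa.
by rewrite xS // IH ?eu // ltnW.
Qed.

(** Old and new controls both sum to [b - a], so every step size keeps the end point; the line
    search keeps the states in [U]. *)
Lemma step_feasible : feasible U T a b x' u'.
Proof.
have [alpha [inU _] [ex eu]] := step_spec; have [alpha' _ [_ xa xS]] := step.
split=> //; first by move=> t tT; rewrite ex //; exact: inU.
rewrite ex // xstepE // big_split /= sumrN sum_utilde sum_feasible subrr.
by rewrite scaler0 addr0; have [] := fxu.
Qed.

Lemma step_energy beta : in_chart U F T a b x u beta ->
  energy F T x' u' <= energy F T (xstep x u beta) (ustep x u beta).
Proof.
have [alpha [_ ls] [ex eu]] := step_spec => inb.
rewrite (@eq_energy x' u' (xstep x u alpha) (ustep x u alpha)) //; first exact: ls.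
by move=> t tT; rewrite ex // ltnW.
Qed.

(** The step size 0 reproduces the current iterate and competes in the exact line search. *)
Lemma step_energy_le : energy F T x' u' <= energy F T x u.
Proof.
have x0 t : (t <= T)%N -> xstep x u 0 t = x t.
  by move=> tT; rewrite xstepE // scale0r addr0.
rewrite (@eq_energy x u (xstep x u 0) (ustep x u 0)).
- by apply: step_energy => t tT; rewrite x0 //; have [+ _ _ _] := fxu; exact.
- by move=> t tT; rewrite x0 // ltnW.
- by move=> t tT; rewrite ustepE scale0r addr0.
Qed.

End OneStep.
End FromFeasible.
End Step.

(** * Criticality and descent directions at a limit point *)

Section LimitPoint.
Context {R : realType} {d : nat} (U : set 'cV[R]_d)
  (F : 'cV[R]_d -> 'cV[R]_d -> R) (T : nat) (a b : 'cV[R]_d).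
Hypotheses (openU : open U) (finslerF : finsler_metric U F) (T_gt0 : (0 < T)%N).
Variables (xs w : nat -> 'cV[R]_d) (r : nat -> R).
(** The limit velocity is kept as length times nonzero direction, so that [Gs] can be taken at the
    direction even where [r t = 0]. *)
Let us t := r t *: w t.
Let Gs t := fundamental_tensor F (xs t) (w t).
Let nus t := r t ^+ 2 *: grad (fun y => F y (w t) ^+ 2) (xs t).
Let zs t := \sum_(t.+1 <= j < T) nus j.
Hypotheses (w0 : forall t, (t < T)%N -> w t != 0)
  (r0 : forall t, (t < T)%N -> 0 <= r t) (fxu : feasible U T a b xs us).

Let pGs t : (t < T)%N -> posdef (Gs t).
Proof.
have [Uxs _ _ _] := fxu.
by move=> tT; apply: (posdef_tensor finslerF); [exact/Uxs/ltnW|exact: w0].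
Qed.

(** Summation by parts turns the terms in [dx] into terms in [du], which yields the adjoint sums
    [zs]. *)
Lemma is_derive_energy_sum (dx du : nat -> 'cV[R]_d) : dx 0%N = 0 ->
  (forall t, (t < T)%N -> dx t.+1 = dx t + du t) ->
  is_derive (0 : R) 1
    (fun s : R => \sum_(t < T) F (xs t + s *: dx t) (us t + s *: du t) ^+ 2)
    (\sum_(t < T) dot (du t) (zs t + 2 *: (Gs t *m us t))).
Proof.
move=> dx0 dxS; have [Uxs _ _ _] := fxu.
have H (t : 'I_T) := is_derive_finsler_sqr openU finslerF (dx t) (du t)
  (Uxs t (ltnW (ltn_ord t))) (w0 (ltn_ord t)) (r0 (ltn_ord t)).
have := is_derive_sum H; congr is_derive.
  by apply/funext => s; rewrite fct_sumE.
under [in RHS]eq_bigr do rewrite dotDr.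
rewrite !big_split /= (dot_sum_by_parts nus dx0 dxS); congr (_ + _).
by apply: eq_bigr => t _; rewrite dotZr.
Qed.

Lemma near_state (dx : nat -> 'cV[R]_d) : \forall s \near (0 : R),
  forall t : 'I_T.+1, U (xs t + s *: dx t).
Proof.
have [Uxs _ _ _] := fxu.
apply: (@filter_forall _ _ (fun (t : 'I_T.+1) s => U (xs t + s *: dx t))
  (nbhs (0 : R)) _) => t.
have c : (xs t + s *: dx t) @[s --> (0 : R)] --> xs t.
  rewrite -[X in _ --> X]addr0 -[X in _ + X](scale0r (dx t)).
  by apply: cvgD; [exact: cvg_cst|apply: cvgZr_tmp; exact: cvg_id].
apply: c; apply: (open_nbhs_nbhs (conj openU _)); apply: Uxs.
by rewrite -ltnS.
Qed.

(** By stationarity each bracket [zs t + 2 *: (Gs t *m us t)] is the same constant vector, and the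
    [du t] sum to [dx T - dx 0 = 0]. *)
Lemma control_critical : (forall t, (t < T)%N -> control T a b Gs zs t = us t) ->
  critical_point U F T a b xs us.
Proof.
move=> cu; split=> // dx du dx0 dxT dxS.
have := is_derive_energy_sum dx0 dxS.
have -> : \sum_(t < T) dot (du t) (zs t + 2 *: (Gs t *m us t)) = 0.
  transitivity (- dot (\sum_(t < T) du t) (multiplier T a b Gs zs)).
    rewrite dot_suml -sumrN; apply: eq_bigr => t _.
    rewrite -cu // (control_eq a b zs pGs (ltn_ord t)) opprD addrCA subrr addr0.
    by rewrite -scaleN1r dotZr mulN1r.
  have := sum_increments dxS (leqnn T); rewrite dxT dx0 add0r => <-.
  by rewrite dot0l oppr0.
(* [quad] is the squared metric only over [U], where the varied states lie for small [s]. *)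
apply: near_eq_is_derive; near=> s.
rewrite (energyE openU finslerF) // => t tT.
have tT' : (t < T.+1)%N by exact: leqW.
by have : forall t : 'I_T.+1, U (xs t + s *: dx t);
  [near: s; exact: near_state|move=> /(_ (Ordinal tT'))].
Unshelve. all: by end_near. Qed.

(** The energy has negative derivative along [control - us], so a small positive step lowers it
    while the states stay in the open set [U]. *)
Lemma control_descent t0 : (t0 < T)%N -> control T a b Gs zs t0 != us t0 ->
  exists alpha : R,
   (forall t, (t <= T)%N ->
     U (xs t + alpha *: \sum_(s < t) (control T a b Gs zs s - us s))) /\
   \sum_(t < T) F (xs t + alpha *: \sum_(s < t) (control T a b Gs zs s - us s))
      (us t + alpha *: (control T a b Gs zs t - us t)) ^+ 2 <
   \sum_(t < T) F (xs t) (us t) ^+ 2.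
Proof.
move=> t0T ct0; set du := fun t => control T a b Gs zs t - us t.
pose dx t := \sum_(s < t) du s.
have dx0 : dx 0%N = 0 by rewrite /dx big_ord0.
have dxS t : (t < T)%N -> dx t.+1 = dx t + du t by rewrite /dx big_ord_recr.
have sdu : \sum_(t < T) du t = 0.
  rewrite big_split /= sumrN (sum_control _ _ _ T_gt0 pGs).
  by rewrite (sum_feasible fxu) subrr.
have := is_derive_energy_sum dx0 dxS.
set phi := fun s : R => _; set D := (X in is_derive _ _ _ X).
(* Stationarity eliminates [zs], and the multiplier drops out because the [du t] sum to zero; a
   negative definite form in [du] remains. *)
have D0 : D < 0.
  have -> : D = - (2 * \sum_(t < T) dot (du t) (Gs t *m du t)).
    rewrite mulr_sumr -sumrN /D.
    transitivity (\sum_(t < T) (- (2 * dot (du t) (Gs t *m du t))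
        - dot (du t) (multiplier T a b Gs zs))).
      apply: eq_bigr => t _.
      have e := control_eq a b zs pGs (ltn_ord t).
      have -> : zs t =
          - (2 *: (Gs t *m control T a b Gs zs t)) - multiplier T a b Gs zs.
        by rewrite e opprK addrAC subrr add0r.
      have -> : - (2 *: (Gs t *m control T a b Gs zs t)) - multiplier T a b Gs zs
          + 2 *: (Gs t *m us t) =
          - (2 *: (Gs t *m du t)) - multiplier T a b Gs zs.
        by rewrite /du mulmxBr scalerBr opprB addrAC; congr (_ + _); rewrite addrC.
      by rewrite dotBr -scaleN1r !dotZr mulN1r.
    rewrite big_split /= [X in _ + X]sumrN -dot_suml sdu dot0l oppr0 addr0.
    by [].
  rewrite oppr_lt0 mulr_gt0 // (bigD1 (Ordinal t0T)) //= ltr_pwDl //.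
    by apply: pGs => //; rewrite subr_eq0.
  apply: sumr_ge0 => t _; have [->|dt0] := eqVneq (du t) 0; first by rewrite dot0l.
  by rewrite ltW // pGs.
move=> [dphi ephi].
have c : h^-1 *: ((phi \o shift 0) (h *: 1) - phi 0) @[h --> (0 : R)^'] --> D.
  by rewrite -ephi; exact: dphi.
have n1 : \forall h \near (0 : R)^'+,
    h^-1 *: ((phi \o shift 0) (h *: 1) - phi 0) < 0.
  exact: cvgr_lt (cvg_dnbhs_at_right c) _ D0.
have nU : \forall h \near (0 : R)^'+, forall t : 'I_T.+1, U (xs t + h *: dx t).
  exact: (cvg_within _ (near_state dx)).
near (0 : R)^'+ => alpha.
have alpha0 : 0 < alpha by [].
exists alpha; split.
  move=> t tT; have : forall t : 'I_T.+1, U (xs t + alpha *: dx t) by near: alpha.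
  by move=> /(_ (Ordinal (tT : (t < T.+1)%N))).
have : alpha^-1 *: ((phi \o shift 0) (alpha *: 1) - phi 0) < 0 by near: alpha.
rewrite /= addr0 [alpha *: 1]mulr1 [_ *: _]mulrC pmulr_llt0 ?invr_gt0 // subr_lt0.
rewrite {2}/phi; under [in X in _ < X]eq_bigr do rewrite !scale0r !addr0.
by [].
Unshelve. all: by end_near. Qed.

End LimitPoint.

(** * Convergence of the energies *)

Section GlobalConvergence.
Context {R : realType} {d : nat} (U : set 'cV[R]_d)
  (F : 'cV[R]_d -> 'cV[R]_d -> R) (T : nat) (a b : 'cV[R]_d).
Hypotheses (openU : open U) (finslerF : finsler_metric U F) (T_gt0 : (0 < T)%N).
Variables x u : nat -> nat -> 'cV[R]_d.
Hypotheses (start : feasible U T a b (x 0%N) (u 0%N))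
  (run : forall i, georce_step U F T a b (x i) (u i) (x i.+1) (u i.+1))
  (u_neq0 : forall i t, (t < T)%N -> u i t != 0)
  (stay_in_chart : forall t, (t <= T)%N ->
      closure (range (fun i => x i t)) `<=` U).
Local Notation E := (fun i => energy F T (x i) (u i)).

Lemma georce_feasible i : feasible U T a b (x i) (u i).
Proof.
elim: i => [|i IH]; first exact: start.
exact: (step_feasible finslerF T_gt0 IH (@u_neq0 i) (run i)).
Qed.

Lemma georce_energyE i : E i = \sum_(t < T) F (x i t) (u i t) ^+ 2.
Proof.
have [Ux _ _ _] := georce_feasible i.
by apply: (energyE openU finslerF) => t /ltnW; exact: Ux.
Qed.

Lemma georce_nonincreasing : nonincreasing_seq E.
Proof.
apply/nonincreasing_seqP => i.
exact: (step_energy_le (georce_feasible i) (run i)).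
Qed.

Lemma georce_energy_cvg : cvgn E.
Proof.
apply: nonincreasing_is_cvgn georce_nonincreasing _.
exists 0 => _ [i _ <-]; rewrite georce_energyE.
by apply: sumr_ge0 => t _; exact: sqr_ge0.
Qed.

Lemma georce_term_le i t : (t < T)%N -> F (x i t) (u i t) ^+ 2 <= E 0%N.
Proof.
move=> tT; apply: le_trans (georce_nonincreasing (leq0n i)).
rewrite georce_energyE (bigD1 (Ordinal tT)) //= lerDl.
by apply: sumr_ge0 => s _; exact: sqr_ge0.
Qed.

(** * Limits of the iterates along an ultrafilter finer than [\oo] *)

Section AlongUltrafilter.
Context {Fi : set_system nat} {FU : UltraFilter Fi}.
Hypothesis Fi_oo : \oo `<=` Fi.

Lemma georce_velocity t xt : (t < T)%N -> U xt -> x i t @[i --> Fi] --> xt ->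
  exists (w : 'cV[R]_d) (r : R), [/\ w != 0, 0 <= r,
    (`|u i t|^-1 *: u i t) @[i --> Fi] --> w,
    `|u i t| @[i --> Fi] --> r & u i t @[i --> Fi] --> r *: w].
Proof.
move=> tT Uxt cx.
apply: (@ultra_velocity _ _ U F openU finslerF _ _ _
  (fun i => x i t) (fun i => u i t) _ (E 0%N) Uxt cx).
- by near=> i; exact: u_neq0.
- by near=> i; exact: georce_term_le.
Unshelve. all: by end_near. Qed.

(** Induction along the curve: a convergent state in [U] makes its velocity converge, hence the next
    state; the limit is in the closure of the iterates, so in [U]. *)
Lemma georce_state_cvg t : (t <= T)%N ->
  exists2 xt : 'cV[R]_d, U xt & x i t @[i --> Fi] --> xt.
Proof.
elim: t => [|t IH] tT.
  have xa i : x i 0%N = a by have [] := georce_feasible i.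
  exists (x 0%N 0%N); first by have [+ _ _ _] := georce_feasible 0; exact.
  by apply: cvg_near_cst; near=> i; rewrite !xa.
have [xt Uxt cx] := IH (ltnW tT).
have [w [r [_ _ _ _ cu]]] := georce_velocity tT Uxt cx.
have cS : x i t.+1 @[i --> Fi] --> xt + r *: w.
  have -> : (fun i => x i t.+1) = (fun i => x i t + u i t).
    by apply/funext => i; have [_ _ _ ->] := georce_feasible i.
  exact: cvgD cx cu.
exists (xt + r *: w) => //; apply: (stay_in_chart tT).
apply: (closed_cvg _ (@closed_closure _ _) _ _ cS).
by near=> i; apply: subset_closure; exists i.
Unshelve. all: by end_near. Qed.

Section LimitOfUpdates.
Variables (xs w : nat -> 'cV[R]_d) (r : nat -> R).
Hypotheses
  (cx : forall t, (t <= T)%N -> U (xs t) /\ x i t @[i --> Fi] --> xs t)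
  (cw : forall t, (t < T)%N -> [/\ w t != 0, 0 <= r t,
    (`|u i t|^-1 *: u i t) @[i --> Fi] --> w t,
    `|u i t| @[i --> Fi] --> r t & u i t @[i --> Fi] --> r t *: w t]).
Let us t := r t *: w t.
Let Gs t := fundamental_tensor F (xs t) (w t).
Let nus t := r t ^+ 2 *: grad (fun y => F y (w t) ^+ 2) (xs t).
Let zs t := \sum_(t.+1 <= j < T) nus j.

Lemma limit_feasible : feasible U T a b xs us.
Proof.
have haus := @norm_hausdorff R 'cV[R]_d.
split=> [t tT|||t tT]; first by have [] := cx tT.
- have [_ c] := cx (leq0n T); apply: (cvg_unique haus c).
  by apply: cvg_near_cst; near=> i; have [] := georce_feasible i.
- have [_ c] := cx (leqnn T); apply: (cvg_unique haus c).
  by apply: cvg_near_cst; near=> i; have [] := georce_feasible i.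
- have [_ c] := cx tT; have [_ c'] := cx (ltnW tT); have [_ _ _ _ cu] := cw tT.
  apply: (cvg_unique haus c).
  have -> : (fun i => x i t.+1) = (fun i => x i t + u i t).
    by apply/funext => i; have [_ _ _ ->] := georce_feasible i.
  exact: cvgD c' cu.
Unshelve. all: by end_near. Qed.

(** 0-homogeneity replaces [u i t] by its direction, whose limit is nonzero even if [u i t] tends to
    0. *)
Lemma limit_Gt t : (t < T)%N -> Gt F (x i) (u i) t @[i --> Fi] --> Gs t.
Proof.
move=> tT; have [Uxt c] := cx (ltnW tT); have [w0 _ cwt _ _] := cw tT.
have -> : (fun i => Gt F (x i) (u i) t) =
    (fun i => fundamental_tensor F (x i t) (`|u i t|^-1 *: u i t)).
  apply/funext => i; have [Ux _ _ _] := georce_feasible i.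
  rewrite (tensor_hom openU finslerF) //; [exact/Ux/ltnW|exact: u_neq0|].
  by rewrite invr_gt0 normr_gt0 u_neq0.
exact: (cvg_tensor openU finslerF Uxt w0 c cwt).
Qed.

Lemma limit_nu t : (t < T)%N -> nu F (x i) (u i) t @[i --> Fi] --> nus t.
Proof.
move=> tT; have [Uxt c] := cx (ltnW tT); have [w0 _ cwt cr _] := cw tT.
have -> : (fun i => nu F (x i) (u i) t) =
    (fun i => `|u i t| ^+ 2 *:
      grad (fun y => F y (`|u i t|^-1 *: u i t) ^+ 2) (x i t)).
  apply/funext => i; have [Ux _ _ _] := georce_feasible i.
  have ui0 := u_neq0 i tT.
  rewrite -(grad_quad_x openU finslerF) ?normalize_neq0 ?normalizeK //.
  exact/Ux/ltnW.
apply: cvgZ; last exact: (cvg_grad_x openU finslerF Uxt w0 c cwt).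
by rewrite expr2; under eq_fun do rewrite expr2; exact: cvgM.
Qed.

Lemma limit_zeta_nu t : (t < T)%N ->
  zeta_nu F T (x i) (u i) t @[i --> Fi] --> zs t.
Proof.
move=> tT; have -> : (fun i => zeta_nu F T (x i) (u i) t) =
    (fun i => \sum_(t.+1 <= j < T) nu F (x i) (u i) j).
  apply/funext => i; have [Ux _ _ _] := georce_feasible i.
  rewrite /zeta_nu /zeta (grad_quad_v openU finslerF) ?add0r //; last exact: u_neq0.
  exact/Ux/ltnW.
rewrite /zs big_nat_cond; under eq_fun do rewrite big_nat_cond.
by apply: cvg_bigsum => j /andP[/andP[_ jT] _]; exact: limit_nu.
Qed.

Let pGs t : (t < T)%N -> posdef (Gs t).
Proof.
move=> tT; have [Uxt _] := cx (ltnW tT); have [w0 _ _ _ _] := cw tT.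
exact: (posdef_tensor finslerF).
Qed.

Lemma limit_utilde t : (t < T)%N ->
  utilde F T a b (x i) (u i) t @[i --> Fi] --> control T a b Gs zs t.
Proof.
have cinv s : (s < T)%N -> invmx (Gt F (x i) (u i) s) @[i --> Fi] --> invmx (Gs s).
  by move=> sT; apply: cvg_invmx; [exact/posdef_unit/pGs|exact: limit_Gt].
have cmu : mu F T a b (x i) (u i) @[i --> Fi] --> multiplier T a b Gs zs.
  apply: cvg_mulmx.
    apply: cvg_invmx; last by apply: cvg_bigsum => s _; exact: cinv.
    apply/posdef_unit/(@posdef_sum _ _ T (fun t => invmx (Gs t))) => // s sT.
    exact/posdef_inv/pGs.
  apply: cvgB; first exact: cvg_cst.
  apply: cvg_bigsum => s _.
  by apply: cvg_mulmx; [exact: cinv|exact: limit_zeta_nu].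
move=> tT; apply: cvgZ; first exact: cvg_cst.
apply: cvg_mulmx; first exact: cinv.
by apply: cvgD; [exact: cmu|exact: limit_zeta_nu].
Qed.

(** The energies converge along [\oo], so the finer ultrafilter has the same limit. *)
Lemma limit_energy : \sum_(t < T) F (xs t) (us t) ^+ 2 = limn E.
Proof.
have c1 : E i @[i --> Fi] --> limn E.
  exact: cvg_trans (cvg_fmap2 Fi_oo) georce_energy_cvg.
have c2 : E i @[i --> Fi] --> \sum_(t < T) F (xs t) (us t) ^+ 2.
  under eq_fun do rewrite georce_energyE.
  apply: cvg_bigsum => t _; have [Uxt c] := cx (ltnW (ltn_ord t)).
  have [_ _ _ _ cu] := cw (ltn_ord t).
  exact: (ultra_cvg_finsler_sqr openU finslerF Uxt c cu).
exact: (cvg_unique (@Rhausdorff R) c2 c1).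
Qed.

(* Otherwise a fixed step along the limit direction would, by continuity, push
   the energy of some iterate below its limit. *)
Lemma limit_control t : (t < T)%N -> control T a b Gs zs t = us t.
Proof.
move=> tT; apply/eqP/negP => /negP ct.
have w0 s : (s < T)%N -> w s != 0 by move=> /cw [].
have r0 s : (s < T)%N -> 0 <= r s by move=> /cw [].
have [alpha [inU]] :=
  control_descent openU finslerF T_gt0 w0 r0 limit_feasible tT ct.
set phi := (X in X < _); rewrite limit_energy => phiE.
have cxs s : (s <= T)%N -> xstep F T a b (x i) (u i) alpha s @[i --> Fi] -->
    xs s + alpha *: \sum_(k < s) (control T a b Gs zs k - us k).
  move=> sT; under eq_fun do rewrite (xstepE F (georce_feasible _) alpha sT).
  have [_ c] := cx sT; apply: cvgD; first exact: c.
  apply: cvgZ; first exact: cvg_cst.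
  apply: cvg_bigsum => k _; have kT : (k < T)%N by exact: leq_trans (ltn_ord k) sT.
  have [_ _ _ _ cu] := cw kT.
  by apply: cvgB; [exact: limit_utilde|exact: cu].
have cus s : (s < T)%N -> ustep F T a b (x i) (u i) alpha s @[i --> Fi] -->
    us s + alpha *: (control T a b Gs zs s - us s).
  move=> sT; under eq_fun do rewrite ustepE.
  have [_ _ _ _ cu] := cw sT; apply: cvgD; first exact: cu.
  apply: cvgZ; first exact: cvg_cst.
  by apply: cvgB; [exact: limit_utilde|exact: cu].
(* The step size [alpha] is admissible for eventually all iterates: [U] is open and there are
   finitely many states. *)
have inc : \forall i \near Fi, in_chart U F T a b (x i) (u i) alpha.
  have : \forall i \near Fi, forall s : 'I_T.+1,
      U (xstep F T a b (x i) (u i) alpha s).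
    apply: (@filter_forall _ _ (fun (s : 'I_T.+1) i =>
      U (xstep F T a b (x i) (u i) alpha s)) Fi _) => s.
    have sT : (s <= T)%N by rewrite -ltnS.
    by apply: (cxs _ sT); apply: open_nbhs_nbhs; split; [exact: openU|exact: inU].
  by apply: filterS => i Ui s sT; exact: (Ui (Ordinal (sT : (s < T.+1)%N))).
have cphi : (\sum_(s < T) F (xstep F T a b (x i) (u i) alpha s)
    (ustep F T a b (x i) (u i) alpha s) ^+ 2) @[i --> Fi] --> phi.
  apply: cvg_bigsum => s _; have sT := ltn_ord s.
  exact: (ultra_cvg_finsler_sqr openU finslerF (inU _ (ltnW sT))
    (cxs _ (ltnW sT)) (cus _ sT)).
have : limn E <= phi; last by rewrite leNgt phiE.
apply: (cvgr_to_ge cphi); near=> i.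
(* The next energy is at least the limit of the decreasing energies and, by the line search, at most
   the energy at the competing step [alpha]. *)
apply: (@le_trans _ _ (E i.+1)).
  exact: (nonincreasing_cvgn_ge georce_nonincreasing georce_energy_cvg).
have ini : in_chart U F T a b (x i) (u i) alpha by near: i.
rewrite -(energyE openU finslerF); first exact: (step_energy (run i)).
by move=> s /ltnW; exact: ini.
Unshelve. all: by end_near. Qed.

Lemma limit_critical : critical_point U F T a b xs us.
Proof.
apply: (control_critical openU finslerF _ _ limit_feasible limit_control).
- by move=> t /cw [].
- by move=> t /cw [].
Qed.

End LimitOfUpdates.
End AlongUltrafilter.

(** The whole sequence of energies converges by monotonicity; the ultrafilter only identifies its
    limit as the energy of a critical point. *)
Lemma georce_limit_critical : exists xs us : nat -> 'cV[R]_d,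
  critical_point U F T a b xs us /\ E @ \oo --> energy F T xs us.
Proof.
have [Fi [FU Fi_oo]] := ultraFilterLemma (F := \oo) _.
have [xs cx] : exists xs : nat -> 'cV[R]_d, forall t, (t <= T)%N ->
    U (xs t) /\ x i t @[i --> Fi] --> xs t.
  have /choice[xs xsP] : forall t, exists xt : 'cV[R]_d, (t <= T)%N ->
      U xt /\ x i t @[i --> Fi] --> xt.
    (* Indices beyond [T] are unconstrained, so 0 serves as a filler there. *)
    move=> t; have [tT|_] := leqP t T; last by exists 0.
    by have [xt Uxt c] := georce_state_cvg tT; exists xt.
  by exists xs.
have [w [r cw]] : exists (w : nat -> 'cV[R]_d) (r : nat -> R),
    forall t, (t < T)%N -> [/\ w t != 0, 0 <= r t,
    (`|u i t|^-1 *: u i t) @[i --> Fi] --> w t,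
    `|u i t| @[i --> Fi] --> r t & u i t @[i --> Fi] --> r t *: w t].
  have /choice[wr wrP] : forall t, exists wr : 'cV[R]_d * R, (t < T)%N ->
    [/\ wr.1 != 0, 0 <= wr.2,
    (`|u i t|^-1 *: u i t) @[i --> Fi] --> wr.1,
    `|u i t| @[i --> Fi] --> wr.2 & u i t @[i --> Fi] --> wr.2 *: wr.1].
    move=> t; have [tT|_] := ltnP t T; last by exists (0, 0).
    have [Uxt c] := cx _ (ltnW tT).
    by have [w [r H]] := georce_velocity tT Uxt c; exists (w, r).
  by exists (fun t => (wr t).1), (fun t => (wr t).2).
exists xs, (fun t => r t *: w t); split; first exact: (limit_critical Fi_oo cx cw).
rewrite (energyE openU finslerF); last by move=> t /ltnW /cx [].
by rewrite (limit_energy Fi_oo cx cw); exact: georce_energy_cvg.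
Qed.

End GlobalConvergence.

Unset Implicit Arguments.

Theorem mainTheorem3 (R : realType) (d : nat) (U : set 'cV[R]_d)
    (F : 'cV[R]_d -> 'cV[R]_d -> R) (T : nat) (a b : 'cV[R]_d)
    (x u : nat -> nat -> 'cV[R]_d)
    (openU : open U) (finslerF : finsler_metric U F)
    (T_gt0 : (0 < T)%N) (Ua : U a) (Ub : U b)
    (not_conj : ~ conjugate_points U F a b)
    (crit_min : forall y w, critical_point U F T a b y w ->
      local_min U F T a b y w)
    (start : feasible U T a b (x 0%N) (u 0%N))
    (run : forall i, georce_step U F T a b (x i) (u i) (x i.+1) (u i.+1))
    (* well-definedness: the fundamental tensors at the iterates exist, and the
       iterates do not accumulate outside the chart *)
    (u_neq0 : forall i t, (t < T)%N -> u i t != 0)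
    (stay_in_chart : forall t, (t <= T)%N ->
      closure (range (fun i => x i t)) `<=` U) :
  exists xs us : nat -> 'cV[R]_d,
    local_min U F T a b xs us /\
    (fun i => energy F T (x i) (u i)) @ \oo --> energy F T xs us.
Proof.
have [xs [us [crit cE]]] := georce_limit_critical openU finslerF T_gt0 start run
  u_neq0 stay_in_chart.
by exists xs, us; split; [exact: crit_min|exact: cE].
Qed.
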